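(* There exist separable Banach spaces $X$ and $Y$ such that there is a map $X\to Y$ which is simultaneously a homeomorphism (onto $Y$) and a coarse equivalence, but $X$ and $Y$ are not uniformly homeomorphic.
   Context: For a map $f:(M,d)\to(N,\partial)$ between metric spaces and $t\ge 0$, let $\omega_f(t)=\sup\{\partial(f(x),f(y)) : d(x,y)\le t\}$ and $\rho_f(t)=\inf\{\partial(f(x),f(y)) : d(x,y)\ge t\}$ (with $\inf\emptyset=\infty$). $f$ is coarse if $\omega_f(t)<\infty$ for all $t\ge 0$; expanding if $\lim_{t\to\infty}\rho_f(t)=\infty$; a coarse equivalence if it is coarse, expanding, and cobounded, i.e. $\sup_{y\in N}\partial(y,f(M))<\infty$. A uniform homeomorphism is a bijection $f$ such that $f$ and $f^{-1}$ are uniformly continuous; two spaces are uniformly homeomorphic if there is a uniform homeomorphism between them. *)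

(* Defs.v *)
From HB Require Import structures.
From mathcomp Require Import all_boot all_order all_algebra.
From mathcomp Require Import all_classical all_reals.
From mathcomp Require Import ereal topology normedtype.

Set Implicit Arguments.
Unset Strict Implicit.
Unset Printing Implicit Defensive.

Import Order.TTheory GRing.Theory Num.Theory.
Import numFieldNormedType.Exports.

Local Open Scope classical_set_scope.
Local Open Scope ring_scope.

Definition separable (T : topologicalType) : Prop :=
  exists2 D : set T, countable D & dense D.

(* The metric of a normed space is [`|x - y|]; the moduli are extended reals,
   so that an infinite supremum and the infimum of the empty set are [+oo]. *)

Definition modulus_of_continuity (R : realType) (X Y : normedModType R)
    (f : X -> Y) (t : R) : \bar R :=
  ereal_sup [set `|f p.1 - f p.2|%:E | p in [set p : X * X | `|p.1 - p.2| <= t]].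

Definition modulus_of_expansion (R : realType) (X Y : normedModType R)
    (f : X -> Y) (t : R) : \bar R :=
  ereal_inf [set `|f p.1 - f p.2|%:E | p in [set p : X * X | t <= `|p.1 - p.2|]].

Definition coarse (R : realType) (X Y : normedModType R) (f : X -> Y) : Prop :=
  forall t : R, 0 <= t -> (modulus_of_continuity f t < +oo)%E.

Definition expanding (R : realType) (X Y : normedModType R) (f : X -> Y) : Prop :=
  modulus_of_expansion f t @[t --> +oo] --> +oo%E.

Definition dist_to_set (R : realType) (Y : normedModType R)
    (y : Y) (A : set Y) : \bar R :=
  ereal_inf [set `|y - a|%:E | a in A].

Definition cobounded (R : realType) (X Y : normedModType R) (f : X -> Y) : Prop :=
  (ereal_sup [set dist_to_set y (range f) | y in [set: Y]] < +oo)%E.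

Definition coarse_equivalence (R : realType) (X Y : normedModType R)
    (f : X -> Y) : Prop :=
  [/\ coarse f, expanding f & cobounded f].

Definition homeomorphism (S T : topologicalType) (f : S -> T) : Prop :=
  exists g : T -> S, [/\ cancel f g, cancel g f, continuous f & continuous g].

Definition uniform_homeomorphism (U V : uniformType) (f : U -> V) : Prop :=
  exists g : V -> U,
    [/\ cancel f g, cancel g f, unif_continuous f & unif_continuous g].

Definition uniformly_homeomorphic (U V : uniformType) : Prop :=
  exists f : U -> V, uniform_homeomorphism f.

(* Main.v *)
Require Import Defs.
From HB Require Import structures.
From mathcomp Require Import all_boot all_order all_algebra.
From mathcomp Require Import all_classical all_reals.
From mathcomp Require Import ereal topology normedtype.
From mathcomp Require Import ring lra.

Set Implicit Arguments.
Unset Strict Implicit.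
Unset Printing Implicit Defensive.

Import Order.TTheory GRing.Theory Num.Theory.
Import numFieldNormedType.Exports.

Local Open Scope classical_set_scope.
Local Open Scope ring_scope.

(** The two spaces differ by one summand c0, hidden in an infinite sum that can
    absorb it nonlinearly. Let [Y] be the l1-sum of the finite dimensional
    subspaces of c0 spanned by the first basis vectors. Summation is a quotient
    map [Y -> c0], and it has an explicit continuous right inverse [sec] with
    [|sec x| <= |x|]: clip [x] at the levels [sup_(j >= n) |x_j|] and take the
    successive differences. Let [Y_k] be [Y] with the norm
    [2^-(k+1) |y| + |Q y|], [B] the l1-sum of the [Y_k] and [A] the direct sum
    of c0 and [B].

    Coarse homeomorphism. As a topological space [Y_k] is the product of c0 and
    the kernel of [Q], through [y |-> (Q y, y - sec (Q y))], and on vectors with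
    [|Q y| <= r] the nonlinear term [sec (Q y)] has size at most
    [2^-(k+1) r] in [Y_k]. So a map [A -> B] may permute or rotate the c0 parts
    of the summands as it likes, at a bounded cost, as long as a vector of size
    [r] is changed only in summands with [2^k >~ r]. Absorbing the extra copy of
    c0 is then a matter of the c0 parts alone: the sequence [(x_0, x_1, ...)]
    has to be read as [(x_1, x_2, ...)] in the low positions and as
    [(x_0, x_1, ...)] in the high ones, the change taking place around position
    [log r]. As [r] grows from [2^M] to [2^(M+1)] the vector carried at position
    [M] is rotated past its neighbour. The size [r] is measured by a norm which
    these rotations preserve, so that the inverse map can read off the same
    rotations; the resulting bijection [absorb] is even bi-Lipschitz. Correcting
    by [sec] gives [check_in], a homeomorphism for which both it and its inverse
    are Lipschitz up to an additive constant.

    No uniform homeomorphism. It would restrict to a uniformly continuous map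
    [f] from c0 to [B] which distorts large distances by bounded factors
    ([no_embedding]). Choose [u], [v] far apart for which [|f u - f v|] nearly
    realises the best Lipschitz constant for large distances. In c0 all vectors
    of a large ball supported far out, translated by [(u + v) / 2], are
    midpoints of [u] and [v]. Their images are approximate midpoints of [f u]
    and [f v], and since the norm of [B] is an l1-sum they are, up to a small
    error, contained in finitely many summands [Y_k] ([midpoint_tail]). But
    finitely many [Y_k] are isomorphic to [Y], where bounded sequences have
    weak* limits along which distances add up as in l1. Hence a uniformly
    continuous map to [Y] concentrates ([gen1_concentrated]): on the sums of many
    small steps [t 1_(J, n_1] + ... + t 1_(J, n_K]] it is nearly constant for
    generic [n_1, ..., n_K], because an interlaced change of all the [n_i] moves
    such a sum by [t] only, while the changes of the image add up over [i]. Two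
    far apart sums then have images which are too close. *)

(** Linear arithmetic on the goal alone, with the norms as indeterminates. *)
Ltac norm_lra := do ?[move: (`|_|) => ?]; clear; lra.

(** * Banach spaces from a norm on a subspace *)

Definition cauchy_for (R : realType) (W : zmodType) (n : W -> R)
    (u : nat -> W) : Prop :=
  forall e : R, 0 < e ->
    exists N, forall i j, (N <= i)%N -> (N <= j)%N -> n (u i - u j) <= e.

Definition tends_to (R : realType) (W : zmodType) (n : W -> R)
    (u : nat -> W) (l : W) : Prop :=
  forall e : R, 0 < e -> exists N, forall i, (N <= i)%N -> n (u i - l) <= e.

Lemma complete_seq (R : realType) (V : completeNormedModType R) (u : nat -> V) :
  cauchy_for Num.norm u -> exists l, tends_to Num.norm u l.
Proof.
move=> uc; have : cvg (u @ \oo).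
  apply/cauchy_cvgP/cauchy_ballP => e e0; near_simpl.
  have [N HN] := uc (e / 2) (divr_gt0 e0 (ltr0Sn _ _)).
  exists ([set i | (N <= i)%N], [set i | (N <= i)%N]); first by split; exists N.
  move=> [i j] /= [Ni Nj]; rewrite -ball_normE /=.
  by apply: le_lt_trans (HN _ _ Ni Nj) _; rewrite ltr_pdivrMr// mulr_natr mulr2n ltrDl.
move=> /cvg_ex[l ul]; exists l => e e0.
have /cvgrPdist_le/(_ e e0)[N _ HN] := ul.
by exists N => i Ni; rewrite distrC; exact: HN.
Qed.

(** The norm need only make sense on the subspace; this covers sequence spaces
    inside the space of all sequences as well as closed subspaces. *)
Record banach_subspace (R : realType) (W : lmodType R) := BanachSubspace {
  bs_mem : W -> Prop ;
  bs_norm : W -> R ;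
  bs_mem0 : bs_mem 0 ;
  bs_memZD : forall (a : R) u v, bs_mem u -> bs_mem v -> bs_mem (a *: u + v) ;
  bs_normD : forall u v, bs_mem u -> bs_mem v ->
    bs_norm (u + v) <= bs_norm u + bs_norm v ;
  bs_normZ : forall (a : R) u, bs_mem u -> bs_norm (a *: u) = `|a| * bs_norm u ;
  bs_norm_eq0 : forall u, bs_mem u -> bs_norm u = 0 -> u = 0 ;
  bs_complete : forall u : nat -> W, (forall i, bs_mem (u i)) ->
    cauchy_for bs_norm u -> exists2 l, bs_mem l & tends_to bs_norm u l
}.

Section BanachSpaceOf.
Variables (R : realType) (W : lmodType R) (S : banach_subspace W).

Definition bs_pred : {pred W} := fun u => `[< bs_mem S u >].

Lemma bs_submod_closed : submod_closed bs_pred.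
Proof.
split; first by apply/asboolP; exact: bs_mem0.
by move=> a u v /asboolP Pu /asboolP Pv; apply/asboolP; exact: bs_memZD.
Qed.

HB.instance Definition _ := GRing.isSubmodClosed.Build R W bs_pred bs_submod_closed.

Record banach_of := BanachOf { bs_val : W ; bs_valP : bs_val \in bs_pred }.

HB.instance Definition _ := [isSub for bs_val].
HB.instance Definition _ := [Choice of banach_of by <:].
HB.instance Definition _ := [SubChoice_isSubLmodule of banach_of by <:].

Lemma bs_memP (x : banach_of) : bs_mem S (bs_val x).
Proof. by have /asboolP := bs_valP x. Qed.

Definition banach_norm (x : banach_of) : R := bs_norm S (bs_val x).

Lemma banach_normD (x y : banach_of) :
  banach_norm (x + y) <= banach_norm x + banach_norm y.
Proof. by apply: bs_normD; exact: bs_memP. Qed.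

Lemma banach_normZ (a : R) (x : banach_of) :
  banach_norm (a *: x) = `|a| * banach_norm x.
Proof. by apply: bs_normZ; exact: bs_memP. Qed.

Lemma banach_norm_eq0 (x : banach_of) : banach_norm x = 0 -> x = 0.
Proof. by move=> /(bs_norm_eq0 (bs_memP x)) x0; apply: val_inj. Qed.

HB.instance Definition _ := Lmodule_isNormed.Build R banach_of
  banach_normD banach_normZ banach_norm_eq0.

(** Completeness for sequences suffices: a Cauchy filter contains balls of
    radius [1/(n+1)], and their centres form a Cauchy sequence with the same
    limit. *)
Lemma banach_complete (F : set_system banach_of) :
  ProperFilter F -> cauchy F -> cvg F.
Proof.
move=> FF /cauchyP Fc.
have /choice[x Fx] : forall n : nat, exists x, F (ball x (n.+1%:R^-1 : R)).
  by move=> n; apply: Fc.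
have xx i j : `|x i - x j| <= i.+1%:R^-1 + j.+1%:R^-1.
  have [z []] := filter_ex (filterI (Fx i) (Fx j)).
  rewrite -!ball_normE /= => xi xj.
  apply: le_trans (ler_distD z _ _) _.
  by rewrite lerD ?ltW// distrC.
have inv_le (e : R) : 0 < e -> exists N, forall i, (N <= i)%N -> i.+1%:R^-1 <= e.
  move=> e0; exists (Num.trunc e^-1) => i Ni.
  rewrite -[e]invrK lef_pV2 ?posrE ?invr_gt0//.
  have /ltW/le_trans := truncnS_gt e^-1; apply.
  by rewrite ler_nat.
have xc : cauchy_for (bs_norm S) (fun i => bs_val (x i)).
  move=> e e0; have [N HN] := inv_le (e / 2) (divr_gt0 e0 (ltr0Sn _ _)).
  exists N => i j Ni Nj; have := xx i j.
  rewrite /Num.norm /= /banach_norm /= => /le_trans -> //.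
  by rewrite (splitr e) lerD// HN.
have [l Pl ul] := bs_complete (fun i => bs_memP (x i)) xc.
apply/cvg_ex; exists (BanachOf (asboolT Pl)).
apply/fcvg_ballP => e e0.
have [N HN] := ul (e / 2 / 2) (divr_gt0 (divr_gt0 e0 (ltr0Sn _ _)) (ltr0Sn _ _)).
have [M HM] := inv_le (e / 2) (divr_gt0 e0 (ltr0Sn _ _)).
pose k := maxn N M.
apply: filterS (Fx k) => y; rewrite -!ball_normE /= => xky.
have := HN k (leq_maxl _ _) => xkl.
have {}xkl : `|x k - BanachOf (asboolT Pl)| <= e / 2 / 2 by [].
have := HM k (leq_maxr _ _) => ke.
apply: (le_lt_trans (ler_distD (x k) _ _)); rewrite distrC (splitr e).
apply: ler_ltD; last exact: lt_le_trans xky ke.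
by apply: le_trans xkl _; lra.
Qed.

HB.instance Definition _ := Uniform_isComplete.Build banach_of banach_complete.

Definition mkB (w : W) (Pw : bs_mem S w) : banach_of := BanachOf (asboolT Pw).

End BanachSpaceOf.

(** * Norms given as suprema; the spaces c0 and l1(V) *)

Section SupOf.
Variables (R : realType) (I : pointedType).
Implicit Type f : I -> R.

Definition sup_of f : R := sup (range f).

Lemma sup_of_ub f M : (forall i, f i <= M) -> forall i, f i <= sup_of f.
Proof.
move=> fM i; apply: ub_le_sup; last by exists i.
by exists M => _ [j _ <-].
Qed.

Lemma sup_of_le f M : (forall i, f i <= M) -> sup_of f <= M.
Proof.
move=> fM; apply: ge_sup; first by exists (f point), point.
by move=> _ [j _ <-].
Qed.

Lemma sup_of_approx f M e : (forall i, f i <= M) -> 0 < e ->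
  exists i, sup_of f <= f i + e.
Proof.
move=> fM e0; have [] := @sup_adherent _ (range f) e e0.
  by split; [exists (f point), point | exists M => _ [j _ <-]].
by move=> _ [i _ <-] /ltW; rewrite lerBlDr; exists i.
Qed.

Lemma sup_ofZ (a : R) f M : 0 <= a -> (forall i, f i <= M) ->
  sup_of (fun i => a * f i) = a * sup_of f.
Proof.
move=> a0 fM; apply/eqP; rewrite eq_le; apply/andP; split.
  by apply: sup_of_le => i; rewrite ler_wpM2l// (sup_of_ub fM).
have [a00|an0] := eqVneq a 0; last have {}a0 : 0 < a by rewrite lt_def an0.
  rewrite a00 mul0r; apply: le_trans (@sup_of_ub _ 0 _ point); first by rewrite mul0r.
  by move=> i; rewrite mul0r.
rewrite -ler_pdivlMl//; apply: sup_of_le => i; rewrite ler_pdivlMl//.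
apply: (@sup_of_ub (fun i => a * f i) (a * M)) => j.
by rewrite ler_wpM2l// ltW.
Qed.

End SupOf.

Lemma le_eps (R : realType) (x y : R) : (forall e, 0 < e -> x <= y + e) -> x <= y.
Proof. by move=> H; apply/ler_addgt0Pr. Qed.

Section C0.
Variable R : realType.
Local Notation W := (nat -> R).

Definition c0_mem (u : W) : Prop :=
  forall e : R, 0 < e -> exists N, forall j, (N <= j)%N -> `|u j| <= e.
Definition c0_norm (u : W) : R := sup_of (fun j => `|u j|).

Lemma c0_bounded u : c0_mem u -> exists M, forall j, `|u j| <= M.
Proof.
move=> /(_ 1 ltr01)[N HN]; exists (1 + \sum_(k < N) `|u k|) => j.
have s0 : 0 <= \sum_(k < N) `|u k| by exact: sumr_ge0.
have [Nj|jN] := leqP N j; first by apply: le_trans (HN j Nj) _; rewrite lerDl.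
rewrite (bigD1 (Ordinal jN))//= addrCA lerDl.
by rewrite addr_ge0// sumr_ge0.
Qed.

Lemma c0_norm_ub u : c0_mem u -> forall j, `|u j| <= c0_norm u.
Proof. by move=> /c0_bounded[M uM] j; apply: (sup_of_ub uM). Qed.

Lemma c0_mem0 : c0_mem 0.
Proof. by move=> e e0; exists 0%N => j _; rewrite normr0 ltW. Qed.

Lemma c0_memZD (a : R) u v : c0_mem u -> c0_mem v -> c0_mem (a *: u + v).
Proof.
move=> Pu Pv e e0.
have a1 : 0 < 1 + `|a| by rewrite ltr_pwDl.
have e2 : 0 < e / 2 by lra.
have [N HN] := Pu (e / 2 / (1 + `|a|)) (divr_gt0 e2 a1).
have [M HM] := Pv (e / 2) e2.
exists (maxn N M) => j; rewrite geq_max => /andP[Nj Mj].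
apply: le_trans (ler_normD _ _) _; rewrite (splitr e) lerD ?HM// normrM.
have := HN j Nj; rewrite ler_pdivlMr//; apply: le_trans.
by rewrite mulrC ler_wpM2l// lerDr.
Qed.

Lemma c0_normD u v : c0_mem u -> c0_mem v ->
  c0_norm (u + v) <= c0_norm u + c0_norm v.
Proof.
move=> Pu Pv; apply: sup_of_le => j.
by apply: le_trans (ler_normD _ _) _; rewrite lerD ?c0_norm_ub.
Qed.

Lemma c0_normZ (a : R) u : c0_mem u -> c0_norm (a *: u) = `|a| * c0_norm u.
Proof.
move=> /c0_bounded[M uM]; rewrite -(sup_ofZ _ uM)//; congr sup_of.
by apply/funext => j; rewrite /= normrM.
Qed.

Lemma c0_norm_eq0 u : c0_mem u -> c0_norm u = 0 -> u = 0.
Proof.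
move=> Pu u0; apply/funext => j; apply/eqP; rewrite -normr_le0 -u0.
exact: c0_norm_ub.
Qed.

Lemma c0_complete (u : nat -> W) : (forall i, c0_mem (u i)) ->
  cauchy_for c0_norm u -> exists2 l, c0_mem l & tends_to c0_norm u l.
Proof.
move=> Pu uc.
have Puij i j : c0_mem (u i - u j).
  by rewrite addrC -scaleN1r; exact: c0_memZD.
have /choice[l ul] : forall k, exists l, tends_to Num.norm (fun i => u i k) l.
  move=> k; apply: complete_seq => e /uc[N HN]; exists N => i j Ni Nj.
  by apply: le_trans (HN i j Ni Nj); exact: (c0_norm_ub (Puij i j) k).
have Hl e : 0 < e -> exists N, forall i, (N <= i)%N -> forall k, `|u i k - l k| <= e.
  move=> /uc[N HN]; exists N => i Ni k; apply: le_eps => d d0.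
  have [M HM] := ul k d d0.
  apply: le_trans (ler_distD (u (maxn N M) k) _ _) _; apply: lerD.
    by apply: le_trans (HN i _ Ni (leq_maxl N M)); exact: (c0_norm_ub (Puij i _) k).
  by apply: HM; rewrite leq_maxr.
exists l.
  move=> e e0; have e2 : 0 < e / 2 by lra.
  have [N /(_ N (leqnn N)) HN] := Hl _ e2.
  have [M HM] := Pu N _ e2; exists M => j Mj.
  rewrite -[l j](subrK (u N j)) (splitr e); apply: le_trans (ler_normD _ _) _.
  by rewrite lerD ?HM// distrC.
by move=> e /Hl[N HN]; exists N => i Ni; apply: sup_of_le => k; exact: HN.
Qed.

Definition c0_data := BanachSubspace c0_mem0 c0_memZD c0_normD c0_normZ
  c0_norm_eq0 c0_complete.
Definition c0 : completeNormedModType R := banach_of c0_data.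

End C0.
Arguments c0 : clear implicits.

Section C0Theory.
Variable R : realType.
Local Notation X := (c0 R).
Implicit Types x y : X.

Definition co x (j : nat) : R := bs_val x j.

Lemma coD x y j : co (x + y) j = co x j + co y j. Proof. by []. Qed.
Lemma coB x y j : co (x - y) j = co x j - co y j. Proof. by []. Qed.
Lemma coZ a x j : co (a *: x) j = a * co x j. Proof. by []. Qed.
Lemma co0 j : co 0 j = 0. Proof. by []. Qed.
Lemma co_sum (I : Type) (r : seq I) (P : pred I) (F : I -> X) j :
  co (\sum_(i <- r | P i) F i) j = \sum_(i <- r | P i) co (F i) j.
Proof.
by apply: (big_morph (fun x => co x j)) => [x y|]; rewrite ?coD ?co0.
Qed.

Lemma c0P x y : (forall j, co x j = co y j) -> x = y.
Proof. by move=> xy; apply: val_inj; apply/funext. Qed.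

Lemma le_co_norm x j : `|co x j| <= `|x|.
Proof. exact: (c0_norm_ub (@bs_memP _ _ (c0_data R) x)). Qed.

Lemma norm_c0_le x M : (forall j, `|co x j| <= M) -> `|x| <= M.
Proof. exact: sup_of_le. Qed.

Lemma co_vanish x : c0_mem (co x).
Proof. exact: (@bs_memP _ _ (c0_data R) x). Qed.

Definition mkc0 (u : nat -> R) (Pu : c0_mem u) : X := @mkB _ _ (c0_data R) u Pu.
Lemma co_mkc0 u Pu j : co (@mkc0 u Pu) j = u j. Proof. by []. Qed.

End C0Theory.
#[global] Arguments co : simpl never.

Section L1.
Variables (R : realType) (V : completeNormedModType R).
Local Notation W := (nat -> V).

Definition psum (u : W) n : R := \sum_(k < n) `|u k|.
Definition l1_mem (u : W) : Prop := exists M, forall n, psum u n <= M.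
Definition l1_norm (u : W) : R := sup_of (psum u).

Lemma psumD u v n : psum (u + v) n <= psum u n + psum v n.
Proof. by rewrite -big_split/=; apply: ler_sum => i _; exact: ler_normD. Qed.

Lemma psumZ (a : R) u n : psum (a *: u) n = `|a| * psum u n.
Proof. by rewrite mulr_sumr; apply: eq_bigr => i _; rewrite normrZ. Qed.

Lemma psum_ge0 u n : 0 <= psum u n.
Proof. exact: sumr_ge0. Qed.

Lemma le_psum u n k : (k < n)%N -> `|u k| <= psum u n.
Proof.
by move=> kn; rewrite /psum (bigD1 (Ordinal kn))//= lerDl sumr_ge0.
Qed.

Lemma psum_homo u m n : (m <= n)%N -> psum u m <= psum u n.
Proof.
move=> mn; rewrite /psum -(subnK mn) addnC big_split_ord/= lerDl.
exact: sumr_ge0.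
Qed.

Lemma l1_norm_ub u : l1_mem u -> forall n, psum u n <= l1_norm u.
Proof. by move=> [M uM] n; exact: (sup_of_ub uM). Qed.

Lemma l1_mem0 : l1_mem 0.
Proof. by exists 0 => n; rewrite /psum big1// => i _; rewrite normr0. Qed.

Lemma l1_memZD (a : R) u v : l1_mem u -> l1_mem v -> l1_mem (a *: u + v).
Proof.
move=> [M uM] [N vN]; exists (`|a| * M + N) => n.
by apply: le_trans (psumD _ _ _) _; rewrite psumZ lerD// ler_wpM2l.
Qed.

Lemma l1_normD u v : l1_mem u -> l1_mem v -> l1_norm (u + v) <= l1_norm u + l1_norm v.
Proof.
move=> Pu Pv; apply: sup_of_le => n.
by apply: le_trans (psumD _ _ _) _; rewrite lerD ?l1_norm_ub.
Qed.

Lemma l1_normZ (a : R) u : l1_mem u -> l1_norm (a *: u) = `|a| * l1_norm u.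
Proof.
move=> [M uM]; rewrite -(sup_ofZ _ uM)//; congr sup_of.
by apply/funext => n; rewrite psumZ.
Qed.

Lemma l1_norm_eq0 u : l1_mem u -> l1_norm u = 0 -> u = 0.
Proof.
move=> Pu u0; apply/funext => k; apply/eqP; rewrite -normr_le0 -u0.
exact: le_trans (le_psum _ (ltnSn k)) (l1_norm_ub Pu _).
Qed.

Lemma l1_complete (u : nat -> W) : (forall i, l1_mem (u i)) ->
  cauchy_for l1_norm u -> exists2 l, l1_mem l & tends_to l1_norm u l.
Proof.
move=> Pu uc.
have Puij i j : l1_mem (u i - u j).
  by rewrite addrC -scaleN1r; exact: l1_memZD.
have /choice[l ul] : forall k, exists l, tends_to Num.norm (fun i => u i k) l.
  move=> k; apply: complete_seq => e /uc[N HN]; exists N => i j Ni Nj.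
  apply: le_trans (HN i j Ni Nj).
  exact: le_trans (@le_psum (u i - u j) _ _ (ltnSn k)) (l1_norm_ub (Puij i j) _).
have Hn n d : 0 < d -> exists N, forall i, (N <= i)%N -> psum (u i - l) n <= d.
  elim: n d => [|n IH] d d0.
    by exists 0%N => i _; rewrite /psum big_ord0 ltW.
  have d2 : 0 < d / 2 by lra.
  have [N HN] := IH _ d2; have [M HM] := ul n _ d2.
  exists (maxn N M) => i; rewrite geq_max => /andP[Ni Mi].
  by rewrite /psum big_ord_recr (splitr d) lerD ?HN ?HM.
have Hl e : 0 < e -> exists N, forall i, (N <= i)%N -> forall n, psum (u i - l) n <= e.
  move=> /uc[N HN]; exists N => i Ni n; apply: le_eps => d d0.
  have [M HM] := Hn n d d0.
  have -> : u i - l = (u i - u (maxn N M)) + (u (maxn N M) - l).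
    by rewrite addrA subrK.
  apply: le_trans (psumD _ _ _) _; apply: lerD.
    by apply: le_trans (HN i _ Ni (leq_maxl N M)); exact: l1_norm_ub.
  by apply: HM; rewrite leq_maxr.
exists l.
  have [N /(_ N (leqnn N)) HN] := Hl _ ltr01.
  have [M HM] := Pu N; exists (1 + M) => n.
  have -> : l = (-1) *: (u N - l) + u N.
    by rewrite scaleN1r opprB subrK.
  by apply: le_trans (psumD _ _ _) _; rewrite psumZ normrN1 mul1r lerD ?HN.
by move=> e /Hl[N HN]; exists N => i Ni; apply: sup_of_le => k; exact: HN.
Qed.

Definition l1_data := BanachSubspace l1_mem0 l1_memZD l1_normD l1_normZ
  l1_norm_eq0 l1_complete.
Definition l1 : completeNormedModType R := banach_of l1_data.
Implicit Types x y : l1.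

Definition tm x (k : nat) : V := bs_val x k.

Lemma tmD x y k : tm (x + y) k = tm x k + tm y k. Proof. by []. Qed.
Lemma tmN x k : tm (- x) k = - tm x k. Proof. by []. Qed.
Lemma tmB x y k : tm (x - y) k = tm x k - tm y k. Proof. by []. Qed.
Lemma tmZ a x k : tm (a *: x) k = a *: tm x k. Proof. by []. Qed.
Lemma tm0 k : tm 0 k = 0. Proof. by []. Qed.

Lemma l1P x y : (forall k, tm x k = tm y k) -> x = y.
Proof. by move=> xy; apply: val_inj; apply/funext. Qed.

Lemma le_psum_norm x n : psum (tm x) n <= `|x|.
Proof. exact: (l1_norm_ub (@bs_memP _ _ l1_data x)). Qed.

Lemma le_tm_norm x k : `|tm x k| <= `|x|.
Proof. exact: le_trans (le_psum _ (ltnSn k)) (le_psum_norm _ _). Qed.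

Lemma norm_l1_le x M : (forall n, psum (tm x) n <= M) -> `|x| <= M.
Proof. exact: sup_of_le. Qed.

Lemma psum_approx x e : 0 < e -> exists N, `|x| <= psum (tm x) N + e.
Proof. by move=> e0; apply: sup_of_approx e0; exact: le_psum_norm. Qed.

Definition mkl1 (u : nat -> V) (Pu : l1_mem u) : l1 := @mkB _ _ l1_data u Pu.
Lemma tm_mkl1 u Pu k : tm (@mkl1 u Pu) k = u k. Proof. by []. Qed.

Lemma psum_tmD x y n : psum (tm (x + y)) n <= psum (tm x) n + psum (tm y) n.
Proof. exact: psumD. Qed.

Lemma psum_tmB x y n : psum (tm (x - y)) n <= psum (tm x) n + psum (tm y) n.
Proof.
apply: le_trans (psum_tmD _ _ _) _; rewrite lerD2l /psum.
by apply: ler_sum => k _; rewrite tmN normrN.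
Qed.

(** Beyond its first [n] terms the norm of [l1] is again a seminorm. *)
Definition tail x n : R := `|x| - psum (tm x) n.

Lemma tail_le_norm x n : tail x n <= `|x|.
Proof. by rewrite /tail lerBlDr lerDl psum_ge0. Qed.

Lemma sum_le_tail x n m : \sum_(i < m) `|tm x (n + i)%N| <= tail x n.
Proof.
by rewrite /tail lerBrDl; have := le_psum_norm x (n + m);
  rewrite /psum big_split_ord.
Qed.

Lemma tailD x y n : tail (x + y) n <= tail x n + tail y n.
Proof.
rewrite /tail lerBlDr; apply: norm_l1_le => m.
have [mn|/ltnW nm] := leqP m n.
  apply: le_trans (psum_homo _ mn) _; rewrite lerDr addr_ge0// subr_ge0.
    exact: le_psum_norm.
  exact: le_psum_norm.
rewrite -(subnKC nm).
have split z : psum (tm z) (n + (m - n)) =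
    psum (tm z) n + \sum_(i < m - n) `|tm z (n + i)|.
  by rewrite /psum big_split_ord.
rewrite split addrC lerD2r.
apply: le_trans (lerD (sum_le_tail x n (m - n)) (sum_le_tail y n (m - n))).
by rewrite -big_split/=; apply: ler_sum => i _; exact: ler_normD.
Qed.

Lemma tailN x n : tail (- x) n = tail x n.
Proof.
by rewrite /tail normrN; congr (_ - _); apply: eq_bigr => k _; rewrite tmN normrN.
Qed.

Lemma tailB x y n : tail (x - y) n <= tail x n + tail y n.
Proof. by rewrite -(tailN y); exact: tailD. Qed.

End L1.
Arguments l1 {R} V.
#[global] Arguments tm : simpl never.

Section ClosedSubspace.
Variables (R : realType) (V : completeNormedModType R) (C : V -> Prop).
Hypothesis C_mem0 : C 0.
Hypothesis C_memZD : forall (a : R) u v, C u -> C v -> C (a *: u + v).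
Hypothesis C_closed : forall (u : nat -> V) l,
  (forall i, C (u i)) -> tends_to Num.norm u l -> C l.

Lemma closed_complete (u : nat -> V) : (forall i, C (u i)) ->
  cauchy_for Num.norm u -> exists2 l, C l & tends_to Num.norm u l.
Proof. by move=> Cu /complete_seq[l ul]; exists l => //; exact: C_closed ul. Qed.

Definition closed_subspace_data : banach_subspace V :=
  BanachSubspace C_mem0 C_memZD (fun u v _ _ => ler_normD u v)
    (fun a u _ => normrZ a u) (fun u _ => @normr0_eq0 _ _ u) closed_complete.

End ClosedSubspace.

(** * A quotient map onto c0 and a continuous right inverse *)

Section SumsTo.
Variables (R : realType) (V : completeNormedModType R).

(** The quotient map, as a relation: membership in the spaces below is
    expressed through it, so that it is enough to know that it is linear
    ([sums_toZD]), bounded ([sums_to_norm]) and closed ([sums_to_closed]). *)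
Definition sums_to (u : nat -> V) (x : V) : Prop :=
  tends_to Num.norm (fun n => \sum_(k < n) u k) x.

Lemma sums_to0 : sums_to (fun=> 0) 0.
Proof.
by move=> e e0; exists 0%N => n _; rewrite big1// subr0 normr0 ltW.
Qed.

Lemma sums_toZD (a : R) u v x y : sums_to u x -> sums_to v y ->
  sums_to (fun k => a *: u k + v k) (a *: x + y).
Proof.
move=> ux vy e e0.
have a1 : 0 < 1 + `|a| by rewrite ltr_pwDl.
have e2 : 0 < e / 2 by lra.
have [N HN] := ux (e / 2 / (1 + `|a|)) (divr_gt0 e2 a1).
have [M HM] := vy (e / 2) e2.
exists (maxn N M) => n; rewrite geq_max => /andP[Nn Mn].
rewrite big_split/= -scaler_sumr opprD addrACA -scalerBr.
apply: le_trans (ler_normD _ _) _; rewrite (splitr e) lerD ?HM// normrZ.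
have := HN n Nn; rewrite ler_pdivlMr//; apply: le_trans.
by rewrite mulrC ler_wpM2l// lerDr.
Qed.

Lemma norm_sum_le (u : nat -> V) n : `|\sum_(k < n) u k| <= psum u n.
Proof. exact: ler_norm_sum. Qed.

Lemma sums_to_norm (y : l1 V) x : sums_to (tm y) x -> `|x| <= `|y|.
Proof.
move=> yx; apply: le_eps => e /yx[N /(_ N (leqnn N))].
rewrite distrC => HN; rewrite -[x](subrK (\sum_(k < N) tm y k)) addrC.
apply: le_trans (ler_normD _ _) _; rewrite lerD//.
by apply: le_trans (norm_sum_le _ _) _; exact: le_psum_norm.
Qed.

Lemma sums_to_closed (y : nat -> l1 V) (x : nat -> V) yl xl :
  (forall i, sums_to (tm (y i)) (x i)) ->
  tends_to Num.norm y yl -> tends_to Num.norm x xl -> sums_to (tm yl) xl.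
Proof.
move=> yx yyl xxl e e0; have e3 : 0 < e / 3 by lra.
have [N HN] := yyl _ e3; have [M HM] := xxl _ e3.
set i := maxn N M; have [K HK] := yx i _ e3.
exists K => n /HK Hn.
have H1 : `|\sum_(k < n) tm yl k - \sum_(k < n) tm (y i) k| <= e / 3.
  rewrite -sumrB; apply: le_trans (HN i (leq_maxl _ _)).
  rewrite distrC; apply: le_trans (le_psum_norm (yl - y i) n).
  exact: (@norm_sum_le (tm (yl - y i))).
have H2 := HM i (leq_maxr _ _).
apply: le_trans (ler_distD (\sum_(k < n) tm (y i) k) _ _) _.
have := ler_distD (x i) (\sum_(k < n) tm (y i) k) xl.
by move: H1 H2 Hn; lra.
Qed.

End SumsTo.

Section Clip.
Variable R : realType.
Implicit Types a b r t : R.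

(** Truncation to [[-|a|, |a|]]; the absolute value makes it total in [a]. *)
Definition clip a r : R := Num.max (- `|a|) (Num.min r `|a|).

Lemma clip_le a r : `|clip a r| <= `|a|.
Proof.
have := normr_ge0 a; rewrite /clip ler_norml /Order.max /Order.min.
by case: ifP; case: ifP; lra.
Qed.

Lemma clip_le_norm a r : `|clip a r| <= `|r|.
Proof.
have := normr_ge0 a; rewrite ler_norml /clip /Order.max /Order.min.
have := ler_norm r; have := ler_norm (- r); rewrite normrN.
by case: ifP; case: ifP; lra.
Qed.

Lemma clip_id a r : `|r| <= `|a| -> clip a r = r.
Proof.
rewrite ler_norml /clip /Order.max /Order.min.
by case: ifP; case: ifP; lra.
Qed.

Lemma clip_lip_level a b r : `|clip a r - clip b r| <= `|a - b|.
Proof.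
apply: le_trans (ler_dist_dist a b).
have := ler_norm (`|a| - `|b|); have := ler_norm (- (`|a| - `|b|)).
have := normr_ge0 a; have := normr_ge0 b.
rewrite normrN ler_norml /clip /Order.max /Order.min.
by case: ifP; case: ifP; case: ifP; case: ifP; lra.
Qed.

Lemma clip_lip a r t : `|clip a r - clip a t| <= `|r - t|.
Proof.
have := ler_norm (r - t); have := ler_norm (- (r - t)).
have := normr_ge0 a.
rewrite normrN ler_norml /clip /Order.max /Order.min.
by case: ifP; case: ifP; case: ifP; case: ifP; lra.
Qed.

End Clip.

Section ContinuousSection.
Variable R : realType.
Local Notation X := (c0 R).
Implicit Types x : X.

Lemma clipv_mem (a : R) x : c0_mem (fun j => clip a (co x j)).
Proof.
move=> e /(co_vanish x)[N HN]; exists N => j /HN; apply: le_trans.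
exact: clip_le_norm.
Qed.

Definition clipv (a : R) x : X := mkc0 (clipv_mem a x).

Lemma clipv_lip (a b : R) x x' : `|clipv a x - clipv b x'| <= `|a - b| + `|x - x'|.
Proof.
apply: norm_c0_le => j; rewrite coB /clipv !co_mkc0.
apply: le_trans (ler_distD (clip b (co x j)) _ _) _.
apply: lerD; first exact: clip_lip_level.
by apply: le_trans (clip_lip _ _ _) _; rewrite -coB le_co_norm.
Qed.

(** The distance from [x] to the sequences supported below [n]. *)
Definition tailsup x n : R := sup_of (fun j => `|co x (n + j)|).

Lemma le_tailsup x n j : (n <= j)%N -> `|co x j| <= tailsup x n.
Proof.
move=> nj; rewrite -(subnKC nj).
by apply: (@sup_of_ub _ _ (fun j => `|co x (n + j)|) `|x|) => i; exact: le_co_norm.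
Qed.

Lemma tailsup_le x n M : (forall j, (n <= j)%N -> `|co x j| <= M) -> tailsup x n <= M.
Proof. by move=> H; apply: sup_of_le => j; apply: H; rewrite leq_addr. Qed.

Lemma tailsup_ge0 x n : 0 <= tailsup x n.
Proof. exact: le_trans (le_tailsup x (leqnn n)). Qed.

Lemma norm_tailsup x n : `|tailsup x n| = tailsup x n.
Proof. by rewrite ger0_norm// tailsup_ge0. Qed.

Lemma tailsup_norm x n : tailsup x n <= `|x|.
Proof. by apply: tailsup_le => j _; exact: le_co_norm. Qed.

Lemma tailsup_homo x n : tailsup x n.+1 <= tailsup x n.
Proof. by apply: tailsup_le => j /ltnW; exact: le_tailsup. Qed.

Lemma tailsup_lip x x' n : `|tailsup x n - tailsup x' n| <= `|x - x'|.
Proof.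
suff H z z' : tailsup z n <= tailsup z' n + `|z - z'|.
  by rewrite ler_distl; apply/andP; split; rewrite ?H// lerBlDr distrC H.
apply: tailsup_le => j nj; rewrite -[co z j](subrK (co z' j)) addrC.
by apply: le_trans (ler_normD _ _) _; rewrite lerD ?le_tailsup// -coB le_co_norm.
Qed.

Lemma tailsup_cvg0 x e : 0 < e -> exists n, tailsup x n <= e.
Proof.
by move=> /(co_vanish x)[N HN]; exists N; apply: tailsup_le.
Qed.

(** The entries of [x] beyond [n] are not affected by clipping at either level,
    so [piece x n] is supported on the first [n + 1] entries. The levels
    decrease to 0 and the norms of the pieces telescope. *)
Definition piece x n : X := clipv (tailsup x n) x - clipv (tailsup x n.+1) x.

Lemma piece_norm x n : `|piece x n| <= tailsup x n - tailsup x n.+1.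
Proof.
apply: le_trans (clipv_lip _ _ _ _) _.
by rewrite subrr normr0 addr0 ger0_norm// subr_ge0 tailsup_homo.
Qed.

Lemma piece_supp x n j : (n < j)%N -> co (piece x n) j = 0.
Proof.
move=> nj; rewrite coB !co_mkc0 !clip_id ?subrr// norm_tailsup.
  exact: le_tailsup.
by apply: le_tailsup; exact: ltnW.
Qed.

Lemma piece_lip x x' n : `|piece x n - piece x' n| <= 4 * `|x - x'|.
Proof.
have e a b c d : (a - b) - (c - d) = (a - c) - (b - d) :> X.
  by rewrite !opprB addrACA [RHS]addrACA (addrC (- b)).
rewrite e; apply: le_trans (ler_normB _ _) _.
have := clipv_lip (tailsup x n) (tailsup x' n) x x'.
have := clipv_lip (tailsup x n.+1) (tailsup x' n.+1) x x'.
have := tailsup_lip x x' n; have := tailsup_lip x x' n.+1.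
by lra.
Qed.

Lemma sum_piece x n : \sum_(k < n) piece x k = x - clipv (tailsup x n) x.
Proof.
rewrite (eq_bigr (fun k : 'I_n => - (clipv (tailsup x k.+1) x - clipv (tailsup x k) x))).
  rewrite sumrN -(big_mkord xpredT
    (fun k => clipv (tailsup x k.+1) x - clipv (tailsup x k) x)).
  rewrite telescope_sumr// opprB; congr (_ - _).
  apply: c0P => j; rewrite co_mkc0 clip_id// norm_tailsup.
  exact: le_tailsup.
by move=> k _; rewrite opprB.
Qed.

Lemma piece_sums_to x : sums_to (piece x) x.
Proof.
move=> e /(tailsup_cvg0 x)[N HN]; exists N => n Nn.
rewrite sum_piece addrAC subrr sub0r normrN; apply: norm_c0_le => j.
rewrite co_mkc0; apply: le_trans (clip_le _ _) _.
rewrite norm_tailsup; apply: le_trans HN.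
by apply: tailsup_le => i ni; apply: le_tailsup; exact: leq_trans ni.
Qed.

Lemma sum_piece_norm x m n :
  \sum_(k < n) `|piece x (m + k)| <= tailsup x m - tailsup x (m + n).
Proof.
elim: n => [|n IH]; first by rewrite big_ord0 addn0 subrr.
rewrite big_ord_recr/= addnS; have := piece_norm x (m + n).
by move: IH; lra.
Qed.

Lemma psum_piece x n : psum (piece x) n <= `|x|.
Proof.
have := sum_piece_norm x 0 n; rewrite /psum.
have := tailsup_norm x 0; have := tailsup_ge0 x (0 + n).
by rewrite /= ; under eq_bigr do rewrite add0n; lra.
Qed.

End ContinuousSection.

Section Triangular.
Variable R : realType.
Local Notation X := (c0 R).

(** The l1-sum of the finite dimensional spaces of sequences supported on
    [{0, ..., n}]. It shares with l1 the behaviour of distances along weak*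
    limits, and summation of the terms maps it onto c0. *)
Definition tri_mem (y : l1 X) : Prop :=
  forall n j, (n < j)%N -> co (tm y n) j = 0.

Lemma tri_mem0 : tri_mem 0. Proof. by []. Qed.

Lemma tri_memZD (a : R) u v : tri_mem u -> tri_mem v -> tri_mem (a *: u + v).
Proof.
by move=> Pu Pv n j nj; rewrite tmD tmZ coD coZ Pu// Pv// mulr0 addr0.
Qed.

Lemma tri_closed (u : nat -> l1 X) l : (forall i, tri_mem (u i)) ->
  tends_to Num.norm u l -> tri_mem l.
Proof.
move=> Pu ul n j nj; apply/eqP; rewrite -normr_le0; apply: le_eps => e /ul[N HN].
rewrite add0r; apply: le_trans (HN N (leqnn N)).
apply: le_trans (le_trans (le_co_norm _ j) (le_tm_norm (u N - l) n)).
by rewrite tmB coB (Pu N)// sub0r normrN.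
Qed.

Definition tri_data := closed_subspace_data tri_mem0 tri_memZD tri_closed.
Definition tri : completeNormedModType R := banach_of tri_data.

Definition trv (y : tri) : l1 X := bs_val y.

Lemma trvD y z : trv (y + z) = trv y + trv z. Proof. by []. Qed.
Lemma trvB y z : trv (y - z) = trv y - trv z. Proof. by []. Qed.
Lemma trvZ a y : trv (a *: y) = a *: trv y. Proof. by []. Qed.
Lemma tm_trvZD a y z :
  tm (trv (a *: y + z)) = (fun j => a *: tm (trv y) j + tm (trv z) j).
Proof. by apply/funext => j; rewrite trvD trvZ tmD tmZ. Qed.
Lemma trv_norm y : `|trv y| = `|y|. Proof. by []. Qed.
Lemma trv_supp (y : tri) n j : (n < j)%N -> co (tm (trv y) n) j = 0.
Proof. exact: (@bs_memP _ _ tri_data y). Qed.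

Definition mktri (y : l1 X) (Py : tri_mem y) : tri := @mkB _ _ tri_data y Py.
Lemma trv_mktri y (Py : tri_mem y) : trv (mktri Py) = y. Proof. by []. Qed.

Lemma piece_l1 (x : X) : l1_mem (piece x).
Proof. by exists `|x| => n; exact: psum_piece. Qed.

Lemma piece_tri x : tri_mem (mkl1 (piece_l1 x)).
Proof. by move=> n j nj; rewrite tm_mkl1 piece_supp. Qed.

Definition sec (x : X) : tri := mktri (piece_tri x).

Lemma sec_norm x : `|sec x| <= `|x|.
Proof. by apply: (@norm_l1_le _ _ (trv (sec x))) => n; exact: psum_piece. Qed.

Lemma sec_sums_to x : sums_to (tm (trv (sec x))) x.
Proof. exact: piece_sums_to. Qed.

(** The pieces are Lipschitz, and the sum of their norms beyond the [m]th is
    controlled by the tail of [x] beyond [m]. *)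
Lemma sec_continuous x e : 0 < e ->
  exists2 d, 0 < d & forall x', `|x - x'| <= d -> `|sec x - sec x'| <= e.
Proof.
move=> e0; have e4 : 0 < e / 4 by lra.
have [m xm] := tailsup_cvg0 x e4.
have m0 : 0 < (4 * m%:R + 1 : R) by rewrite ltr_wpDl// mulr_ge0.
exists (e / 4 / (4 * m%:R + 1)); first exact: divr_gt0.
move=> x'; rewrite ler_pdivlMr// => xx'.
have xx'0 := normr_ge0 (x - x').
have lip : `|x - x'| <= e / 4.
  by apply: le_trans xx'; rewrite ler_peMr// lerDr mulr_ge0.
have m4 : 4 * m%:R * `|x - x'| <= e / 4.
  by apply: le_trans xx'; rewrite mulrC ler_wpM2l// lerDl.
rewrite -trv_norm; apply: norm_l1_le => n.
apply: le_trans (psum_homo _ (leq_addl m n)) _.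
rewrite /psum big_split_ord/=.
have H1 : \sum_(i < m) `|tm (trv (sec x - sec x')) i| <= 4 * m%:R * `|x - x'|.
  apply: (@le_trans _ _ (\sum_(i < m) (4 * `|x - x'|))).
    by apply: ler_sum => i _; exact: piece_lip.
  rewrite sumr_const card_ord -mulr_natr le_eqVlt; apply/orP; left; apply/eqP; ring.
have H2 : \sum_(i < n) `|tm (trv (sec x - sec x')) (m + i)| <=
    tailsup x m + tailsup x' m.
  have := sum_piece_norm x m n; have := sum_piece_norm x' m n.
  have := tailsup_ge0 x (m + n); have := tailsup_ge0 x' (m + n).
  have : \sum_(i < n) `|tm (trv (sec x - sec x')) (m + i)| <=
    \sum_(i < n) `|piece x (m + i)| + \sum_(i < n) `|piece x' (m + i)|.
    by rewrite -big_split/=; apply: ler_sum => i _; exact: ler_normB.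
  by lra.
have := tailsup_lip x x' m; have := ler_norm (- (tailsup x m - tailsup x' m)).
rewrite normrN.
move: H1 H2 m4 lip xm; lra.
Qed.

End Triangular.
#[global] Arguments trv : simpl never.

(** * The two spaces *)

Section Spaces.
Variables (R : realType) (d : nat).
Local Notation X := (c0 R).
Local Notation Y := (tri R).
Local Notation W := (l1 X * l1 Y)%type.

(** A vector of the [k]th summand is stored as the pair of its image [x_k] in c0
    and of the multiple [wt k *: y] of a preimage [y] of [x_k]; the norm
    [|x_k| + wt k * |y|] gives less and less weight to the preimage. For [d = 0]
    this is the plain sum [B]; for [d = 1] the term [x_0] has no preimage
    attached, which is the sum [A] of c0 and [B]. As in the hotel of Hilbert,
    the question is how [x_0] can be accommodated in the case [d = 0]. *)
Definition wt (k : nat) : R := 2 ^- k.+1.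

Definition hotel_mem (w : W) : Prop :=
  forall k, sums_to (tm (trv (tm w.2 k))) (wt k *: tm w.1 (d + k)).

Definition hotel_norm (w : W) : R := `|w.1| + `|w.2|.

Lemma hotel_mem0 : hotel_mem 0.
Proof. by move=> k; rewrite tm0 scaler0; exact: sums_to0. Qed.

Lemma hotel_memZD (a : R) u v : hotel_mem u -> hotel_mem v -> hotel_mem (a *: u + v).
Proof.
move=> Pu Pv k.
rewrite -[(a *: u + v).1]/(a *: u.1 + v.1) -[(a *: u + v).2]/(a *: u.2 + v.2).
rewrite !tmD !tmZ tm_trvZD scalerDr scalerA (mulrC (wt k)) -scalerA.
exact: (sums_toZD a (Pu k) (Pv k)).
Qed.

Lemma hotel_normD u v : hotel_mem u -> hotel_mem v ->
  hotel_norm (u + v) <= hotel_norm u + hotel_norm v.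
Proof. by move=> _ _; rewrite /hotel_norm addrACA lerD// ler_normD. Qed.

Lemma hotel_normZ (a : R) u : hotel_mem u -> hotel_norm (a *: u) = `|a| * hotel_norm u.
Proof. by move=> _; rewrite /hotel_norm !normrZ mulrDr. Qed.

Lemma hotel_norm_eq0 u : hotel_mem u -> hotel_norm u = 0 -> u = 0.
Proof.
move=> _ /eqP; rewrite /hotel_norm paddr_eq0// !normr_eq0 => /andP[/eqP u1 /eqP u2].
by rewrite [u]surjective_pairing u1 u2.
Qed.

Lemma hotel_complete (u : nat -> W) : (forall i, hotel_mem (u i)) ->
  cauchy_for hotel_norm u -> exists2 l, hotel_mem l & tends_to hotel_norm u l.
Proof.
move=> Pu uc.
have [l1 ul1] : exists l, tends_to Num.norm (fun i => (u i).1) l.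
  apply: complete_seq => e /uc[N HN]; exists N => i j Ni Nj.
  by apply: le_trans (HN i j Ni Nj); rewrite lerDl.
have [l2 ul2] : exists l, tends_to Num.norm (fun i => (u i).2) l.
  apply: complete_seq => e /uc[N HN]; exists N => i j Ni Nj.
  by apply: le_trans (HN i j Ni Nj); rewrite lerDr.
exists (l1, l2).
  move=> k; apply: (@sums_to_closed _ _ (fun i => trv (tm (u i).2 k))
    (fun i => wt k *: tm (u i).1 (d + k))).
  - by move=> i; exact: Pu.
  - move=> e /ul2[N HN]; exists N => i /HN; apply: le_trans.
    by rewrite -trvB trv_norm -tmB; exact: le_tm_norm.
  - move=> e /ul1[N HN]; exists N => i /HN; apply: le_trans.
    rewrite -scalerBr normrZ; apply: le_trans (le_tm_norm _ (d + k)).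
    rewrite tmB.
    rewrite ler_piMl// ger0_norm ?invr_ge0 ?exprn_ge0//.
    by rewrite invf_le1 ?exprn_gt0// exprn_ege1// ler1n.
move=> e e0; have e2 : 0 < e / 2 by lra.
have [N HN] := ul1 _ e2; have [M HM] := ul2 _ e2.
exists (maxn N M) => i; rewrite geq_max => /andP[Ni Mi].
by rewrite /hotel_norm (splitr e) lerD ?HN ?HM.
Qed.

Definition hotel_data := BanachSubspace hotel_mem0 hotel_memZD hotel_normD
  hotel_normZ hotel_norm_eq0 hotel_complete.
Definition hotel : completeNormedModType R := banach_of hotel_data.
Implicit Types w z : hotel.

Definition rooms w : l1 X := (bs_val w).1.
Definition lifts w : l1 Y := (bs_val w).2.

Lemma roomsD w z : rooms (w + z) = rooms w + rooms z. Proof. by []. Qed.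
Lemma roomsB w z : rooms (w - z) = rooms w - rooms z. Proof. by []. Qed.
Lemma liftsD w z : lifts (w + z) = lifts w + lifts z. Proof. by []. Qed.
Lemma liftsB w z : lifts (w - z) = lifts w - lifts z. Proof. by []. Qed.
Lemma hotel_normE w : `|w| = `|rooms w| + `|lifts w|. Proof. by []. Qed.

Lemma hotel_ext w z : rooms w = rooms z -> lifts w = lifts z -> w = z.
Proof.
move=> wz1 wz2; apply: val_inj; rewrite /= [bs_val w]surjective_pairing.
by rewrite [RHS]surjective_pairing; congr pair.
Qed.

Lemma hotelP w k : sums_to (tm (trv (tm (lifts w) k))) (wt k *: tm (rooms w) (d + k)).
Proof. exact: (@bs_memP _ _ hotel_data w). Qed.

Lemma wt_gt0 k : 0 < wt k.
Proof. by rewrite invr_gt0 exprn_gt0. Qed.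

(** On finitely many summands the lifts alone control the norm; this is what
    makes them isomorphic to sums of copies of [tri]. *)
Lemma room_le_lift w k : `|tm (rooms w) (d + k)| <= 2 ^+ k.+1 * `|tm (lifts w) k|.
Proof.
have := sums_to_norm (hotelP w k); rewrite normrZ gtr0_norm ?wt_gt0//.
by rewrite /wt ler_pdivrMl ?exprn_gt0.
Qed.

Definition mkhotel (x : l1 X) (b : l1 Y) (Pxb : hotel_mem (x, b)) : hotel :=
  @mkB _ _ hotel_data (x, b) Pxb.
Lemma rooms_mk x b Pxb : rooms (@mkhotel x b Pxb) = x. Proof. by []. Qed.
Lemma lifts_mk x b Pxb : lifts (@mkhotel x b Pxb) = b. Proof. by []. Qed.

End Spaces.
#[global] Arguments rooms : simpl never.
#[global] Arguments lifts : simpl never.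

(** * Absorbing a summand by rotations depending on the size *)

Section Givens.
Variables (R : realType) (V : completeNormedModType R).
Local Notation U := (@l1 R V).
Implicit Types (x y z : U) (c s : R) (p n M : nat).

(** All sums below are split around the two terms moved by a rotation. *)
Lemma big_two (A : nmodType) (F : nat -> A) p m :
  \sum_(k < p.+2 + m) F k =
  \sum_(k < p) F k + (F p + F p.+1) + \sum_(i < m) F (p.+2 + i)%N.
Proof. by rewrite big_split_ord/= !big_ord_recr/= addrA. Qed.

(** The rotation in the plane of the terms [p] and [p + 1]. *)
Definition givens_fun p c s (u : nat -> V) : nat -> V := fun k =>
  if k == p then c *: u p + s *: u p.+1
  else if k == p.+1 then - s *: u p + c *: u p.+1 else u k.

Lemma givens_fun_out p c s u k : (k != p) -> (k != p.+1) -> givens_fun p c s u k = u k.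
Proof. by rewrite /givens_fun => /negPf-> /negPf->. Qed.

Lemma givens_fun_fst p c s u : givens_fun p c s u p = c *: u p + s *: u p.+1.
Proof. by rewrite /givens_fun eqxx. Qed.

Lemma givens_fun_snd p c s u : givens_fun p c s u p.+1 = - s *: u p + c *: u p.+1.
Proof. by rewrite /givens_fun eqn_leq ltnn/= eqxx. Qed.

Lemma givens_fun_low p c s u k : (k < p)%N -> givens_fun p c s u k = u k.
Proof. by move=> kp; rewrite givens_fun_out// neq_ltn ?kp// ltnS (ltnW kp). Qed.

Lemma givens_fun_high p c s u k : (p.+1 < k)%N -> givens_fun p c s u k = u k.
Proof.
by move=> kp; rewrite givens_fun_out// neq_ltn ?kp ?orbT// (ltnW kp) orbT.
Qed.

Lemma psum_givens p c s B u n : 1 <= B -> `|c| + `|s| <= B ->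
  psum (givens_fun p c s u) n <= B * psum u (p.+2 + n).
Proof.
move=> B1 csB; have B0 : 0 <= B by apply: le_trans B1.
apply: le_trans (psum_homo _ (leq_addl p.+2 n)) _.
rewrite /psum (big_two (fun k => `|givens_fun p c s u k|)) (big_two (fun k => `|u k|)).
rewrite !mulrDr; apply: lerD; last first.
  rewrite mulr_sumr; apply: ler_sum => i _.
  by rewrite givens_fun_high ?ler_peMl// addSn ltnS addSn ltnS leq_addr.
apply: lerD.
  rewrite mulr_sumr; apply: ler_sum => i _.
  by rewrite givens_fun_low ?ler_peMl.
rewrite givens_fun_fst givens_fun_snd.
have h1 := ler_normD (c *: u p) (s *: u p.+1).
have h2 := ler_normD (- s *: u p) (c *: u p.+1).
rewrite !normrZ in h1 h2; rewrite normrN in h2.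
have h3 : (`|c| + `|s|) * `|u p| <= B * `|u p| by rewrite ler_wpM2r.
have h4 : (`|c| + `|s|) * `|u p.+1| <= B * `|u p.+1| by rewrite ler_wpM2r.
by lra.
Qed.

Lemma givens_mem p c s x : l1_mem (givens_fun p c s (tm x)).
Proof.
exists ((1 + `|c| + `|s|) * `|x|) => n.
apply: le_trans (@psum_givens p c s (1 + `|c| + `|s|) _ _ _ _) _.
- by rewrite -addrA lerDl addr_ge0.
- by rewrite -addrA lerDr.
- by rewrite ler_wpM2l ?le_psum_norm// !addr_ge0.
Qed.

Definition givens p c s x : U := mkl1 (givens_mem p c s x).

Lemma tm_givens p c s x k : tm (givens p c s x) k = givens_fun p c s (tm x) k.
Proof. by []. Qed.

Lemma givens_norm p c s B x : 1 <= B -> `|c| + `|s| <= B ->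
  `|givens p c s x| <= B * `|x|.
Proof.
move=> B1 csB; apply: norm_l1_le => n; apply: le_trans (psum_givens _ _ _ B1 csB) _.
by rewrite ler_wpM2l ?le_psum_norm// (le_trans _ B1).
Qed.

Lemma givensB p c s x y : givens p c s (x - y) = givens p c s x - givens p c s y.
Proof.
apply: l1P => k; rewrite tmB !tm_givens /givens_fun !tmB.
case: ifP => _; last case: ifP => _ //;
  by rewrite !scalerBr opprD addrACA.
Qed.

Lemma givens_id p x : givens p 1 0 x = x.
Proof.
apply: l1P => k; rewrite tm_givens /givens_fun.
case: ifP => [/eqP->|_]; first by rewrite scale1r scale0r addr0.
by case: ifP => [/eqP->|//]; rewrite oppr0 scale1r scale0r add0r.
Qed.

Lemma givensK p c s x : c ^+ 2 + s ^+ 2 = 1 ->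
  givens p c (- s) (givens p c s x) = x.
Proof.
move=> cs; apply: l1P => k; rewrite tm_givens /givens_fun.
rewrite !tm_givens givens_fun_fst givens_fun_snd.
case: ifP => [/eqP->|kp].
  rewrite !scalerDr !scalerA addrACA -!scalerDl.
  have -> : c * c + - s * - s = 1 by rewrite -cs; ring.
  have -> : c * s + - s * c = 0 by ring.
  by rewrite scale1r scale0r addr0.
case: ifP => [/eqP->|kp1]; last by rewrite givens_fun_out ?kp ?kp1.
rewrite !scalerDr !scalerA addrACA -!scalerDl.
have -> : - - s * c + c * - s = 0 by ring.
have -> : - - s * s + c * c = 1 by rewrite -cs; ring.
by rewrite scale1r scale0r add0r.
Qed.

Lemma givens_dist p c s c' s' x : `|givens p c s x - givens p c' s' x| <=
  (`|c - c'| + `|s - s'|) * (`|tm x p| + `|tm x p.+1|).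
Proof.
apply: norm_l1_le => n; apply: le_trans (psum_homo _ (leq_addl p.+2 n)) _.
rewrite /psum (big_two (fun k => `|tm (givens p c s x - givens p c' s' x) k|)).
rewrite big1 => [|i _]; last by rewrite tmB !tm_givens !givens_fun_low// subrr normr0.
rewrite [X in _ + _ + X]big1 => [|i _]; last first.
  rewrite tmB !tm_givens !givens_fun_high ?subrr ?normr0//;
  by rewrite addSn ltnS addSn ltnS leq_addr.
rewrite add0r addr0 !tmB !tm_givens !givens_fun_fst !givens_fun_snd.
have e (a b u v : V) : a + b - (u + v) = (a - u) + (b - v).
  by rewrite opprD addrACA.
rewrite !e -!scalerBl.
have h1 := ler_normD ((c - c') *: tm x p) ((s - s') *: tm x p.+1).
have h2 := ler_normD ((- s - - s') *: tm x p) ((c - c') *: tm x p.+1).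
have h3 : `|- s - - s'| = `|s - s'| by rewrite -opprD normrN.
rewrite !normrZ in h1 h2; rewrite h3 in h2.
by lra.
Qed.

(** The norm of [x] in the injective tensor product of [l2] and [V]: smaller
    than the norm of [l1], larger than the norm of every term, and invariant
    under orthogonal substitutions of the terms. *)
Definition weak_norm x : R := sup_of (fun nd : nat * (nat -> R) =>
  if \sum_(k < nd.1) nd.2 k ^+ 2 <= 1
  then `|\sum_(k < nd.1) nd.2 k *: tm x k| else 0).

Lemma comb_le_norm x n (d : nat -> R) : \sum_(k < n) d k ^+ 2 <= 1 ->
  `|\sum_(k < n) d k *: tm x k| <= `|x|.
Proof.
move=> d1; apply: le_trans (le_psum_norm x n).
apply: le_trans (ler_norm_sum _ _ _) _; apply: ler_sum => i _.
rewrite normrZ ler_piMl//; rewrite -(@expr_le1 _ 2)// -normrX ger0_norm ?sqr_ge0//.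
by apply: le_trans d1; rewrite (bigD1 i)//= lerDl sumr_ge0// => k _; exact: sqr_ge0.
Qed.

Lemma le_weak_norm x n (d : nat -> R) : \sum_(k < n) d k ^+ 2 <= 1 ->
  `|\sum_(k < n) d k *: tm x k| <= weak_norm x.
Proof.
move=> d1; rewrite /weak_norm.
set f := (X in sup_of X).
have := @sup_of_ub _ _ f `|x| _ (n, d); rewrite /f /= d1; apply.
by move=> [m e] /=; case: ifP => // /comb_le_norm.
Qed.

Lemma weak_norm_le x B : 0 <= B -> (forall n (d : nat -> R),
  \sum_(k < n) d k ^+ 2 <= 1 -> `|\sum_(k < n) d k *: tm x k| <= B) ->
  weak_norm x <= B.
Proof.
by move=> B0 H; apply: sup_of_le => -[n d] /=; case: ifP => // /H.
Qed.

Lemma weak_norm_ge0 x : 0 <= weak_norm x.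
Proof.
by have := @le_weak_norm x 0 (fun=> 0); rewrite !big_ord0 normr0; apply.
Qed.

Lemma tm_weak_norm x k : `|tm x k| <= weak_norm x.
Proof.
have := @le_weak_norm x k.+1 (fun j => (j == k)%:R).
rewrite !big_ord_recr/= eqxx scale1r !big1 => [|i _|i _].
- by rewrite !add0r expr1n; apply.
- by rewrite (ltn_eqF (ltn_ord i)) scale0r.
- by rewrite (ltn_eqF (ltn_ord i)) expr0n.
Qed.

Lemma weak_norm_lip x y : weak_norm x <= weak_norm y + `|x - y|.
Proof.
apply: weak_norm_le => [|n d d1]; first by rewrite addr_ge0 ?weak_norm_ge0.
have -> : \sum_(k < n) d k *: tm x k =
    \sum_(k < n) d k *: tm y k + \sum_(k < n) d k *: tm (x - y) k.
  transitivity (\sum_(k < n) (d k *: tm y k + d k *: tm (x - y) k)).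
    by apply: eq_bigr => k _; rewrite -scalerDr -tmD addrC subrK.
  by rewrite big_split.
by apply: le_trans (ler_normD _ _) _; rewrite lerD ?le_weak_norm ?comb_le_norm.
Qed.

(** A linear form [d] of the rotated terms is a linear form [d'] of the terms,
    [d'] being the image of [d] under the transposed rotation. *)
Lemma weak_norm_givens_le p c s x : c ^+ 2 + s ^+ 2 = 1 ->
  weak_norm (givens p c s x) <= weak_norm x.
Proof.
move=> cs; apply: weak_norm_le => [|n d d1]; first exact: weak_norm_ge0.
(* The sum is first extended, by zero coefficients, beyond [p + 1]. *)
pose d0 k := if (k < n)%N then d k else 0.
pose d' k := if k == p then c * d0 p - s * d0 p.+1
             else if k == p.+1 then s * d0 p + c * d0 p.+1 else d0 k.
have pad (A : nmodType) (F G : nat -> A) : (forall k, (k < n)%N -> F k = G k) ->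
    (forall k, (n <= k)%N -> G k = 0) ->
    \sum_(k < n) F k = \sum_(k < p.+2 + n) G k.
  move=> FG G0; rewrite addnC big_split_ord/= [X in _ + X]big1 ?addr0.
    by apply: eq_bigr => k _; exact: FG.
  by move=> i _; rewrite G0// leq_addr.
have d'l k : (k < p)%N -> d' k = d0 k.
  by move=> kp; rewrite /d' !ltn_eqF// ltnS ltnW.
have d'h k : (p.+1 < k)%N -> d' k = d0 k.
  by move=> kp; rewrite /d' !gtn_eqF// ltnW.
have d'p : d' p = c * d0 p - s * d0 p.+1 by rewrite /d' eqxx.
have d'q : d' p.+1 = s * d0 p + c * d0 p.+1 by rewrite /d' eqxx gtn_eqF.
have hi i : (p.+1 < p.+2 + i)%N by rewrite addSn ltnS addSn ltnS leq_addr.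
rewrite (pad _ (fun k => d k *: tm (givens p c s x) k)
  (fun k => d0 k *: tm (givens p c s x) k)); first last.
- by move=> k nk; rewrite /d0 ltnNge nk scale0r.
- by move=> k kn; rewrite /d0 kn.
have -> : \sum_(k < p.+2 + n) d0 k *: tm (givens p c s x) k =
    \sum_(k < p.+2 + n) d' k *: tm x k.
  rewrite (big_two (fun k => d0 k *: tm (givens p c s x) k)).
  rewrite (big_two (fun k => d' k *: tm x k)).
  congr (_ + _ + _).
  - by apply: eq_bigr => i _; rewrite tm_givens givens_fun_low// d'l.
  - rewrite !tm_givens givens_fun_fst givens_fun_snd d'p d'q.
    rewrite !scalerDr !scalerA addrACA -!scalerDl.
    by congr (_ *: _ + _ *: _); ring.
  - by apply: eq_bigr => i _; rewrite tm_givens givens_fun_high// d'h.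
apply: le_weak_norm; move: d1.
rewrite (pad _ (fun k => d k ^+ 2) (fun k => d0 k ^+ 2)); first last.
- by move=> k nk; rewrite /d0 ltnNge nk expr0n.
- by move=> k kn; rewrite /d0 kn.
suff -> : \sum_(k < p.+2 + n) d0 k ^+ 2 = \sum_(k < p.+2 + n) d' k ^+ 2 by [].
rewrite (big_two (fun k => d0 k ^+ 2)) (big_two (fun k => d' k ^+ 2)).
congr (_ + _ + _).
- by apply: eq_bigr => i _; rewrite d'l.
- rewrite d'p d'q; transitivity ((c ^+ 2 + s ^+ 2) * (d0 p ^+ 2 + d0 p.+1 ^+ 2)).
    by rewrite cs mul1r.
  by ring.
- by apply: eq_bigr => i _; rewrite d'h.
Qed.

Lemma weak_norm_givens p c s x : c ^+ 2 + s ^+ 2 = 1 ->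
  weak_norm (givens p c s x) = weak_norm x.
Proof.
move=> cs; apply/eqP; rewrite eq_le weak_norm_givens_le//=.
rewrite -{1}(givensK p x cs) weak_norm_givens_le//.
by rewrite sqrrN.
Qed.

End Givens.

Section Angle.
Variable R : realType.
Implicit Types r t : R.

(** Rational parametrisation of the quarter circle from (1,0) to (0,1). *)
Definition qcos t : R := (1 - t ^+ 2) / (1 + t ^+ 2).
Definition qsin t : R := 2 * t / (1 + t ^+ 2).

Lemma qden_gt0 t : 0 < 1 + t ^+ 2.
Proof. by rewrite ltr_pwDl// sqr_ge0. Qed.

Lemma qcos2Dqsin2 t : qcos t ^+ 2 + qsin t ^+ 2 = 1.
Proof. by rewrite /qcos /qsin; field; rewrite gt_eqF// qden_gt0. Qed.

Lemma qcossin_le t : `|qcos t| + `|qsin t| <= 2.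
Proof.
have sq1 (a b : R) : a ^+ 2 + b ^+ 2 = 1 -> `|a| <= 1.
  move=> ab; rewrite -(@expr_le1 _ 2)// -normrX ger0_norm ?sqr_ge0//.
  by rewrite -ab lerDl sqr_ge0.
have h1 := sq1 _ _ (qcos2Dqsin2 t).
have := qcos2Dqsin2 t; rewrite addrC => /sq1 h2.
by move: h1 h2; lra.
Qed.

Lemma qcos0 : qcos 0 = 1. Proof. by rewrite /qcos expr0n/= subr0 addr0 divr1. Qed.
Lemma qsin0 : qsin 0 = 0. Proof. by rewrite /qsin mulr0 mul0r. Qed.
Lemma qcos1 : qcos 1 = 0. Proof. by rewrite /qcos expr1n subrr mul0r. Qed.
Lemma qsin1 : qsin 1 = 1.
Proof. by rewrite /qsin expr1n mulr1 divff// pnatr_eq0. Qed.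

Lemma qcossin_lip t t' : 0 <= t -> t <= t' -> t' <= 1 ->
  `|qcos t - qcos t'| + `|qsin t - qsin t'| <= 6 * (t' - t).
Proof.
move=> t0 tt' t'1.
have d0 := qden_gt0 t; have d0' := qden_gt0 t'.
have D1 : 1 <= (1 + t ^+ 2) * (1 + t' ^+ 2).
  by rewrite -[leLHS]mulr1 ler_pM// lerDl sqr_ge0.
have D0 := lt_le_trans ltr01 D1.
have -> : qcos t - qcos t' =
    2 * (t' - t) * (t' + t) / ((1 + t ^+ 2) * (1 + t' ^+ 2)).
  by rewrite /qcos; field; rewrite !gt_eqF.
have -> : qsin t - qsin t' =
    - (2 * (t' - t) * (1 - t * t')) / ((1 + t ^+ 2) * (1 + t' ^+ 2)).
  by rewrite /qsin; field; rewrite !gt_eqF.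
have h (a b : R) : 0 <= b -> `|a| <= b ->
    `|a / ((1 + t ^+ 2) * (1 + t' ^+ 2))| <= b.
  move=> b0 ab; rewrite normrM normfV (gtr0_norm D0) ler_pdivrMr//.
  by apply: le_trans ab _; rewrite ler_peMr.
have -> : 6 * (t' - t) = 4 * (t' - t) + 2 * (t' - t) by ring.
apply: lerD; apply: h.
- by rewrite mulr_ge0// subr_ge0.
- rewrite ger0_norm; first by nra.
  by rewrite !mulr_ge0// ?subr_ge0 ?addr_ge0// (le_trans t0).
- by rewrite mulr_ge0// subr_ge0.
- have tt0 : 0 <= t * t' by rewrite mulr_ge0// (le_trans t0).
  have tt1 : t * t' <= 1 by rewrite mulr_ile1// ?(le_trans t0)// (le_trans tt').
  have := mulr_ge0 tt0 (_ : 0 <= t' - t); rewrite subr_ge0 => /(_ tt') tt2.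
  rewrite normrN ger0_norm; first by lra.
  by rewrite !mulr_ge0// ?subr_ge0.
Qed.

(** The [M]th rotation happens while the size runs from [2^M] to [2^(M+1)]. *)
Definition stage (M : nat) r : R := Num.max 0 (Num.min 1 (r / 2 ^+ M - 1)).

Lemma stage_before M r : r <= 2 ^+ M -> stage M r = 0.
Proof.
move=> rM; rewrite /stage; apply/max_idPl; rewrite ge_min; apply/orP; right.
by rewrite subr_le0 ler_pdivrMr ?exprn_gt0// mul1r.
Qed.

Lemma stage_after M r : 2 ^+ M.+1 <= r -> stage M r = 1.
Proof.
move=> rM; rewrite /stage (min_idPl _) ?(max_idPr _)//.
by rewrite lerBrDr ler_pdivlMr ?exprn_gt0// -natr1 -exprS.
Qed.

Lemma stage_within M r : 2 ^+ M <= r -> r <= 2 ^+ M.+1 ->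
  stage M r = r / 2 ^+ M - 1.
Proof.
move=> Mr rM; rewrite /stage (min_idPr _) ?(max_idPr _)//.
  by rewrite subr_ge0 ler_pdivlMr ?exprn_gt0// mul1r.
by rewrite lerBlDr ler_pdivrMr ?exprn_gt0// -natr1 -exprS.
Qed.

Lemma stage_ge0 M r : 0 <= stage M r.
Proof. by rewrite le_max lexx. Qed.

Lemma stage_le1 M r : stage M r <= 1.
Proof. by rewrite ge_max ler01/= ge_min lexx. Qed.

End Angle.

Section Absorb.
Variables (R : realType) (V : completeNormedModType R).
Local Notation U := (@l1 R V).
Implicit Types (x y z : U) (r : R) (p n M : nat).

(** After its quarter turn the [M]th rotation has moved the term [M + 1] to
    position [M] and the vector carried there, which is [x_0] up to sign, to
    position [M + 1], where the next rotation finds it. *)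
Definition turn M r x : U := givens M (qcos (stage M r)) (qsin (stage M r)) x.
Definition unturn M r x : U := givens M (qcos (stage M r)) (- qsin (stage M r)) x.

Fixpoint turns M r x : U := if M is M'.+1 then turn M' r (turns M' r x) else x.
Fixpoint unturns M r x : U := if M is M'.+1 then unturns M' r (unturn M' r x) else x.

Lemma turnK M r : cancel (turn M r) (unturn M r).
Proof. by move=> x; rewrite /turn /unturn givensK ?qcos2Dqsin2. Qed.

Lemma unturnK M r : cancel (unturn M r) (turn M r).
Proof.
move=> x; rewrite /turn /unturn -{1}[qsin _]opprK givensK//.
by rewrite sqrrN qcos2Dqsin2.
Qed.

Lemma turnsK M r : cancel (turns M r) (unturns M r).
Proof. by elim: M => //= M IH x; rewrite turnK IH. Qed.

Lemma unturnsK M r : cancel (unturns M r) (turns M r).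
Proof. by elim: M => //= M IH x; rewrite IH unturnK. Qed.

Lemma turnsB M r x y : turns M r (x - y) = turns M r x - turns M r y.
Proof. by elim: M => //= M ->; rewrite /turn givensB. Qed.

Lemma weak_norm_turns M r x : weak_norm (turns M r x) = weak_norm x.
Proof. by elim: M => //= M IH; rewrite weak_norm_givens ?qcos2Dqsin2. Qed.

Lemma turn_before M r x : r <= 2 ^+ M -> turn M r x = x.
Proof. by move=> rM; rewrite /turn stage_before// qcos0 qsin0 givens_id. Qed.

Lemma pow2_homo m n : (m <= n)%N -> (2 ^+ m <= 2 ^+ n :> R).
Proof. by move=> mn; rewrite ler_eXn2l// ltr1n. Qed.

Lemma turns_stable M M' r x : r <= 2 ^+ M -> (M <= M')%N ->
  turns M' r x = turns M r x.
Proof.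
move=> rM /subnK <-; elim: (M' - M)%N => //= k IH.
rewrite turn_before ?IH//; apply: le_trans rM _.
by rewrite pow2_homo// leq_addl.
Qed.

Lemma turns_const M r r' x : 2 ^+ M <= r -> 2 ^+ M <= r' ->
  turns M r x = turns M r' x.
Proof.
elim: M => //= M IH rM rM'.
rewrite IH ?(le_trans _ rM) ?(le_trans _ rM') ?pow2_homo//.
by rewrite /turn !stage_after.
Qed.

Lemma norm_turn M r B x : 1 <= B ->
  `|qcos (stage M r)| + `|qsin (stage M r)| <= B -> `|turn M r x| <= B * `|x|.
Proof. by move=> B1; exact: givens_norm. Qed.

Lemma norm_unturn M r B x : 1 <= B ->
  `|qcos (stage M r)| + `|qsin (stage M r)| <= B -> `|x| <= B * `|turn M r x|.
Proof.
by move=> B1 HB; rewrite -{1}(turnK M r x); apply: givens_norm; rewrite ?normrN.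
Qed.

(** All the nontrivial rotations but the last are quarter turns, which are isometric,
    so the distortion does not accumulate. *)
Lemma norm_turns_bound M r x :
  (`|turns M r x| <= 2 * `|x| /\ `|x| <= 2 * `|turns M r x|) /\
  (2 ^+ M <= r -> `|turns M r x| = `|x|).
Proof.
elim: M => [|M [[IH1 IH2] IH3]] /=.
  by split=> //; split; rewrite ler_peMl// ler1n.
have B2 : (1 : R) <= 2 by rewrite ler1n.
split.
  have [rM|/ltW Mr] := leP r (2 ^+ M); first by rewrite turn_before.
  rewrite -(IH3 Mr); split.
    exact: norm_turn B2 (qcossin_le _).
  exact: norm_unturn B2 (qcossin_le _).
move=> Mr; have Mr' : 2 ^+ M <= r by apply: le_trans Mr; rewrite pow2_homo.
have B1 : `|qcos (stage M r)| + `|qsin (stage M r)| <= 1.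
  by rewrite stage_after// qcos1 qsin1 normr0 normr1 add0r.
rewrite -(IH3 Mr'); apply/eqP; rewrite eq_le.
have := norm_turn (turns M r x) (lexx _) B1.
have := norm_unturn (turns M r x) (lexx _) B1.
by rewrite !mul1r => -> ->.
Qed.

Lemma norm_turns M r x : `|turns M r x| <= 2 * `|x|.
Proof. by have [[]] := norm_turns_bound M r x. Qed.

Lemma norm_unturns M r x : `|x| <= 2 * `|turns M r x|.
Proof. by have [[]] := norm_turns_bound M r x. Qed.

Lemma tm_turns_high M r x k : (M < k)%N -> tm (turns M r x) k = tm x k.
Proof.
elim: M => //= M IH Mk; rewrite /turn tm_givens givens_fun_high ?IH//.
exact: ltnW.
Qed.

Lemma tm_turns_low M r x k : (k < M)%N -> 2 ^+ k.+1 <= r ->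
  tm (turns M r x) k = tm x k.+1.
Proof.
move=> + kr; elim: M => //= M IH; rewrite ltnS leq_eqVlt => /orP[/eqP<-|kM].
  rewrite /turn tm_givens givens_fun_fst stage_after// qcos1 qsin1 scale0r add0r.
  by rewrite scale1r tm_turns_high.
by rewrite /turn tm_givens givens_fun_low// IH.
Qed.

(** While stage [M] is active the rotation moves only two terms, each of norm
    at most [2^(M+1)], and its angle has Lipschitz constant of order [2^-M]. *)
Lemma turn_lip M r r' x : weak_norm x <= r -> 2 ^+ M <= r -> r <= r' ->
  r' <= 2 ^+ M.+1 -> `|turns M.+1 r x - turns M.+1 r' x| <= 24 * (r' - r).
Proof.
move=> xr Mr rr' rM.
have Mr' := le_trans Mr rr'; have rM' := le_trans rr' rM.
rewrite /= (turns_const x Mr Mr').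
set z := turns M r' x.
have zr : weak_norm z <= r by rewrite weak_norm_turns.
apply: le_trans (givens_dist _ _ _ _ _ _) _.
have P0 : 0 < (2 ^+ M : R) by rewrite exprn_gt0.
have h1 : `|tm z M| <= 2 * 2 ^+ M.
  by rewrite -exprS; exact: le_trans (tm_weak_norm _ _) (le_trans zr rM').
have h2 : `|tm z M.+1| <= 2 * 2 ^+ M.
  by rewrite -exprS; exact: le_trans (tm_weak_norm _ _) (le_trans zr rM').
have tt' : stage M r <= stage M r'.
  by rewrite !stage_within// lerB// ler_pM2r ?invr_gt0.
have := qcossin_lip (stage_ge0 M r) tt' (stage_le1 M r').
set q := _ + _ => qle.
have q0 : 0 <= q by rewrite addr_ge0.
apply: (@le_trans _ _ (6 * (stage M r' - stage M r) * (4 * 2 ^+ M))).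
  apply: ler_pM => //.
  by move: h1 h2; lra.
rewrite !stage_within// le_eqVlt; apply/orP; left; apply/eqP; field.
by rewrite gt_eqF.
Qed.

(** The intermediate sizes [2^M] cut the interval [[r, r']] into pieces to each
    of which [turn_lip] applies. *)
Lemma turns_lip M r r' x : weak_norm x <= r -> r <= r' -> r' <= 2 ^+ M ->
  `|turns M r x - turns M r' x| <= 24 * (r' - r).
Proof.
elim: M r r' => [|M IH] r r' xr rr' rM.
  by rewrite /= subrr normr0 mulr_ge0// subr_ge0.
have [r'M|/ltW Mr'] := leP r' (2 ^+ M).
  rewrite /= !turn_before//; last exact: le_trans rr' _.
  exact: IH.
have [rM'|/ltW Mr] := leP r (2 ^+ M); last exact: turn_lip.
have h1 := IH r (2 ^+ M) xr rM' (lexx _).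
have h2 := turn_lip (le_trans xr rM') (lexx _) Mr' rM.
have e1 : turns M.+1 r x = turns M r x by rewrite /= turn_before.
have e2 : turns M.+1 (2 ^+ M) x = turns M (2 ^+ M) x by rewrite /= turn_before.
rewrite e1; rewrite e2 in h2.
apply: le_trans (ler_distD (turns M (2 ^+ M) x) _ _) _.
by move: h1 h2; lra.
Qed.

(** Rotations with [2^M >= r] are trivial, so any number of them beyond this
    one can be applied ([absorbE]). *)
Definition level r : nat := (Num.trunc r).+1.

Lemma le_level r : r <= 2 ^+ level r.
Proof.
apply: le_trans (ltW (truncnS_gt r)) _; rewrite -natrX ler_nat.
by apply: ltnW; exact: ltn_expl.
Qed.

Definition absorb x : U := turns (level (weak_norm x)) (weak_norm x) x.
Definition unabsorb x : U := unturns (level (weak_norm x)) (weak_norm x) x.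

Lemma weak_norm_absorb x : weak_norm (absorb x) = weak_norm x.
Proof. exact: weak_norm_turns. Qed.

Lemma weak_norm_unabsorb x : weak_norm (unabsorb x) = weak_norm x.
Proof.
by rewrite -(weak_norm_turns (level (weak_norm x)) (weak_norm x)) unturnsK.
Qed.

Lemma absorbK : cancel absorb unabsorb.
Proof. by move=> x; rewrite /unabsorb weak_norm_absorb turnsK. Qed.

Lemma unabsorbK : cancel unabsorb absorb.
Proof. by move=> x; rewrite /absorb weak_norm_unabsorb unturnsK. Qed.

Lemma absorbE M x : weak_norm x <= 2 ^+ M -> absorb x = turns M (weak_norm x) x.
Proof.
move=> xM; have [lM|/ltnW Ml] := leqP (level (weak_norm x)) M.
  by rewrite (turns_stable x (le_level _) lM).
by rewrite /absorb (turns_stable x xM Ml).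
Qed.

Lemma tm_absorb x k : 2 ^+ k.+1 <= weak_norm x -> tm (absorb x) k = tm x k.+1.
Proof.
move=> kx; rewrite (@absorbE (maxn k.+1 (level (weak_norm x)))).
  by rewrite tm_turns_low// leq_maxl.
by apply: le_trans (le_level _) _; rewrite pow2_homo// leq_maxr.
Qed.

(** Both estimates compare [absorb x] and [absorb y] with the rotations of [x]
    at the larger of the two sizes, where they are linear. *)
Lemma absorb_lip_wlog (x y : U) : weak_norm x <= weak_norm y ->
  `|absorb x - absorb y| <= 26 * `|x - y| /\ `|x - y| <= 2 * `|absorb x - absorb y| +
     48 * (weak_norm y - weak_norm x).
Proof.
move=> xy; have yM := le_level (weak_norm y); move: yM.
set M := level _ => yM; have xM := le_trans xy yM.
rewrite (absorbE xM) (absorbE yM).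
have h1 := turns_lip (lexx _) xy yM.
have h2 := norm_turns M (weak_norm y) (x - y).
have h3 := norm_unturns M (weak_norm y) (x - y).
have h4 := weak_norm_lip y x; rewrite distrC in h4.
have h5 := ler_distD (turns M (weak_norm y) x) (turns M (weak_norm x) x)
  (turns M (weak_norm y) y).
have h6 := ler_distD (turns M (weak_norm x) x) (turns M (weak_norm y) x)
  (turns M (weak_norm y) y).
rewrite turnsB in h2 h3; rewrite (distrC _ (turns M (weak_norm x) x)) in h6.
move: h1 h2 h3 h4 h5 h6; do ?[move: (`|_|) => ?].
by move: (weak_norm x) (weak_norm y) => r s; clear; split; lra.
Qed.

Lemma absorb_lip x y : `|absorb x - absorb y| <= 26 * `|x - y|.
Proof.
have [xy|/ltW yx] := leP (weak_norm x) (weak_norm y).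
  by have [] := absorb_lip_wlog xy.
by have [] := absorb_lip_wlog yx; rewrite distrC (distrC y).
Qed.

Lemma unabsorb_lip x y : `|unabsorb x - unabsorb y| <= 50 * `|x - y|.
Proof.
wlog xy : x y / weak_norm x <= weak_norm y.
  move=> H; have [xy|/ltW yx] := leP (weak_norm x) (weak_norm y); first exact: H.
  by rewrite distrC (distrC x); exact: H.
have := @absorb_lip_wlog (unabsorb x) (unabsorb y).
rewrite !weak_norm_unabsorb !unabsorbK => /(_ xy)[_].
have := weak_norm_lip y x; rewrite (distrC y).
by lra.
Qed.

End Absorb.

(** * The coarse homeomorphism *)

Section CoarseCriteria.
Variables (R : realType) (A B : completeNormedModType R).

Lemma continuous_eps (f : A -> B) :
  (forall x e, 0 < e -> exists2 d, 0 < d &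
    forall y, `|x - y| <= d -> `|f x - f y| <= e) -> continuous f.
Proof.
move=> H x; apply/cvgrPdist_le => e e0; have [d d0 Hd] := H x e e0.
apply/nbhs_ballP; exists d => // y; rewrite -ball_normE /= => xy.
by apply: Hd; exact: ltW.
Qed.

Lemma coarse_equivalence_of_inverse (f : A -> B) (g : B -> A) (L C : R) :
  0 < L -> 0 <= C -> cancel f g -> cancel g f ->
  (forall x y, `|f x - f y| <= L * `|x - y| + C) ->
  (forall x y, `|g x - g y| <= L * `|x - y| + C) ->
  coarse_equivalence f.
Proof.
move=> L0 C0 fK gK fL gL; split.
- move=> t t0; apply: (@le_lt_trans _ _ (L * t + C)%:E); last exact: ltry.
  apply: ge_ereal_sup => _ [[x y] /= xy <-]; rewrite lee_fin.
  by apply: le_trans (fL x y) _; rewrite lerD2r ler_pM2l.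
- apply/cvgeyPge => a; exists (L * a + C); split; first exact: num_real.
  move=> t ta; apply: le_ereal_inf_tmp => _ [[x y] /= xy <-]; rewrite lee_fin.
  have := gL (f x) (f y); rewrite !fK => h; rewrite -(ler_pM2l L0).
  by move: (le_trans xy h) ta; lra.
- apply: (@le_lt_trans _ _ 0%:E); last exact: ltry.
  apply: ge_ereal_sup => _ [y _ <-]; apply: ereal_inf_lbound.
  by exists y; [exists (g y)|rewrite subrr normr0].
Qed.

End CoarseCriteria.

Section Front.
Variable R : realType.
Local Notation X := (c0 R).
Local Notation Y := (tri R).
Implicit Types (x : l1 X) (k n : nat).

Lemma wt_le1 k : wt R k <= 1.
Proof.
by rewrite invf_le1 ?exprn_gt0// exprn_ege1// ler1n.
Qed.

Lemma psum_wsec x n : psum (fun k => wt R k *: sec (tm x k)) n <= psum (tm x) n.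
Proof.
apply: ler_sum => k _; rewrite normrZ gtr0_norm ?wt_gt0//.
by apply: le_trans (sec_norm _); rewrite ler_piMl// wt_le1.
Qed.

Lemma wsec_mem x : l1_mem (fun k => wt R k *: sec (tm x k)).
Proof.
by exists `|x| => n; apply: le_trans (psum_wsec _ _) (le_psum_norm _ _).
Qed.

Definition wsec x : l1 Y := mkl1 (wsec_mem x).

Lemma tm_wsec x k : tm (wsec x) k = wt R k *: sec (tm x k).
Proof. by []. Qed.

Lemma wsec_sums_to x k : sums_to (tm (trv (tm (wsec x) k))) (wt R k *: tm x k).
Proof.
have := sums_toZD (wt R k) (sec_sums_to (tm x k)) (@sums_to0 _ X).
rewrite addr0; congr sums_to; apply/funext => j.
by rewrite tm_wsec trvZ tmZ addr0.
Qed.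

(** Finitely many terms are handled by the continuity of [sec], the others by
    the tail of [x]. *)
Lemma wsec_continuous x e : 0 < e -> exists2 d, 0 < d &
  forall y, `|x - y| <= d -> `|wsec x - wsec y| <= e.
Proof.
move=> e0; have e8 : 0 < e / 8 by lra.
have [N HN] := psum_approx x e8.
have tx : tail x N <= e / 8 by rewrite /tail lerBlDl.
have fin M eps : 0 < eps -> exists2 d, 0 < d &
    forall y, `|x - y| <= d -> psum (tm (wsec x - wsec y)) M <= eps.
  elim: M eps => [|M IH] eps eps0.
    by exists 1 => // y _; rewrite /psum big_ord0 ltW.
  have h2 : 0 < eps / 2 by lra.
  have [d d0 Hd] := IH _ h2; have [d' d'0 Hd'] := sec_continuous (tm x M) h2.
  exists (Num.min d d'); first by rewrite lt_min d0.
  move=> y; rewrite le_min => /andP[xd xd'].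
  rewrite /psum big_ord_recr/= (splitr eps); apply: lerD; first exact: Hd.
  rewrite tmB !tm_wsec -scalerBr normrZ gtr0_norm ?wt_gt0//.
  apply: (@le_trans _ _ `|sec (tm x M) - sec (tm y M)|).
    by rewrite ler_piMl// wt_le1.
  by apply: Hd'; rewrite -tmB; apply: le_trans xd'; exact: le_tm_norm.
have e2 : 0 < e / 2 by lra.
have [d d0 Hd] := fin N _ e2.
exists (Num.min d (e / 8)); first by rewrite lt_min d0.
move=> y; rewrite le_min => /andP[xd xe].
apply: norm_l1_le => n; apply: le_trans (psum_homo _ (leq_addl N n)) _.
rewrite /psum big_split_ord/=.
have h1 := Hd y xd; rewrite /psum in h1.
have h2 : \sum_(i < n) `|tm (wsec x - wsec y) (N + i)%N| <= tail x N + tail y N.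
  apply: le_trans (lerD (sum_le_tail x N n) (sum_le_tail y N n)).
  rewrite -big_split/=; apply: ler_sum => i _; rewrite tmB.
  apply: le_trans (ler_normB _ _) _; rewrite !tm_wsec !normrZ gtr0_norm ?wt_gt0//.
  by apply: lerD; apply: le_trans (sec_norm _); rewrite ler_piMl// wt_le1.
have h3 : tail y N <= tail x N + `|x - y|.
  have := tailB x (x - y) N; rewrite opprB addrC subrK => h.
  by apply: le_trans h _; rewrite lerD2l tail_le_norm.
by move: h1 h2 h3 tx xe; lra.
Qed.

Lemma psum_shift x n : psum (fun k => tm x k.+1) n <= `|x|.
Proof.
apply: le_trans (le_psum_norm x n.+1); rewrite /psum big_ord_recl/=.
by rewrite lerDr.
Qed.

Lemma shift_mem x : l1_mem (fun k => tm x k.+1).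
Proof. by exists `|x| => n; exact: psum_shift. Qed.

Definition shift x : l1 X := mkl1 (shift_mem x).
Lemma tm_shift x k : tm (shift x) k = tm x k.+1. Proof. by []. Qed.

Lemma shiftB x y : shift (x - y) = shift x - shift y.
Proof. by apply: l1P => k; rewrite tmB !tm_shift tmB. Qed.

Lemma norm_shift x : `|shift x| <= `|x|.
Proof. by apply: norm_l1_le => n; exact: psum_shift. Qed.

(** The terms with [2^(k+1) <= weak_norm x] are equal, and beyond them the
    weights form a geometric series. *)
Lemma wsec_absorb_near x : `|wsec (absorb x) - wsec (shift x)| <= 4.
Proof.
set r := weak_norm x; have r0 : 0 <= r by exact: weak_norm_ge0.
set u := wsec _ - wsec _.
have u0 k : 2 ^+ k.+1 <= r -> `|tm u k| = 0.
  by move=> kr; rewrite tmB !tm_wsec tm_absorb// tm_shift subrr normr0.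
have u1 k : `|tm u k| <= 2 * r / 2 ^+ k.+1.
  rewrite tmB !tm_wsec -scalerBr normrZ gtr0_norm ?wt_gt0// mulrC ler_pM2r ?wt_gt0//.
  apply: le_trans (ler_normB _ _) _.
  have h1 := le_trans (sec_norm (tm (absorb x) k)) (tm_weak_norm (absorb x) k).
  have h2 := le_trans (sec_norm (tm (shift x) k)) (tm_weak_norm x k.+1).
  by rewrite weak_norm_absorb in h1; move: h1 h2; rewrite -/r; lra.
(* The bound [4 - 2 r / 2^n] is 4 minus the rest of the geometric series. *)
have H n : psum (tm u) n <= if 2 ^+ n <= r then 0 else 4 - 2 * r / 2 ^+ n.
  elim: n => [|n IH].
    by rewrite /psum big_ord0 expr0 divr1; case: (leP 1 r) => //; lra.
  rewrite /psum big_ord_recr/= -/(psum (tm u) n).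
  have P0 : 0 < (2 ^+ n : R) by rewrite exprn_gt0.
  case: (leP (2 ^+ n.+1) r) => [nr|rn].
    rewrite u0// addr0; apply: le_trans IH _; rewrite ifT//.
    by apply: le_trans nr; rewrite exprS; lra.
  have half : 2 * r / 2 ^+ n = 2 * (2 * r / 2 ^+ n.+1).
    by rewrite exprS; field; rewrite gt_eqF.
  have := u1 n; case: (leP (2 ^+ n) r) IH => [nr|rn'] IH h1; last first.
    by move: IH h1; rewrite half; lra.
  have h2 : 2 * r / 2 ^+ n.+1 <= 2.
    by rewrite ler_pdivrMr ?exprn_gt0// ler_pM2l// ltW.
  by move: IH h1 h2; lra.
apply: norm_l1_le => n; apply: le_trans (H n) _; case: ifP => // _.
by rewrite lerBlDr lerDl divr_ge0 ?mulr_ge0 ?exprn_ge0.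
Qed.

Lemma addr_detourK (M : zmodType) (a b c : M) : a + (b - c) + (c - b) = a.
Proof. by rewrite -addrA -(opprB b c) subrr addr0. Qed.

Lemma tm_trvD3 (a b c : Y) j : tm (trv (a + (b - c))) j =
  1 *: tm (trv a) j + ((-1) *: tm (trv c) j + tm (trv b) j).
Proof.
by rewrite trvD trvB tmD tmB scale1r scaleN1r (addrC (- tm (trv c) j)).
Qed.

Lemma sums_to_swap (a b c : Y) (x z : X) : sums_to (tm (trv a)) x ->
  sums_to (tm (trv b)) z -> sums_to (tm (trv c)) x ->
  sums_to (tm (trv (a + (b - c)))) z.
Proof.
move=> ax bz cx.
have := sums_toZD 1 ax (sums_toZD (-1) cx bz).
rewrite scale1r scaleN1r addrA subrr add0r; congr sums_to.
by apply/funext => j; rewrite tm_trvD3.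
Qed.

Lemma check_in_mem (w : hotel R 1) :
  hotel_mem 0 (absorb (rooms w),
    lifts w + (wsec (absorb (rooms w)) - wsec (shift (rooms w)))).
Proof.
move=> k; rewrite [in X in sums_to X]/= tmD tmB.
apply: sums_to_swap (hotelP w k) (wsec_sums_to _ _) _.
by rewrite add1n -tm_shift; exact: wsec_sums_to.
Qed.

(** The kernel parts stay where they are: [lifts w - wsec (shift (rooms w))]
    maps to 0, and is completed to a lift of the new rooms. *)
Definition check_in (w : hotel R 1) : hotel R 0 := mkhotel (check_in_mem w).

Lemma check_out_mem (w : hotel R 0) :
  hotel_mem 1 (unabsorb (rooms w),
    lifts w + (wsec (shift (unabsorb (rooms w))) - wsec (rooms w))).
Proof.
move=> k; rewrite [in X in sums_to X]/= tmD tmB.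
apply: sums_to_swap (hotelP w k) _ (wsec_sums_to _ _).
by rewrite add1n -tm_shift; exact: wsec_sums_to.
Qed.

Definition check_out (w : hotel R 0) : hotel R 1 := mkhotel (check_out_mem w).

Lemma check_inK : cancel check_in check_out.
Proof.
move=> w; have e : rooms (check_out (check_in w)) = rooms w.
  by rewrite !rooms_mk absorbK.
apply: hotel_ext => //; rewrite lifts_mk -[unabsorb _]/(rooms (check_out (check_in w))) e.
by rewrite lifts_mk rooms_mk addr_detourK.
Qed.

Lemma check_outK : cancel check_out check_in.
Proof.
move=> w; have e : rooms (check_in (check_out w)) = rooms w.
  by rewrite !rooms_mk unabsorbK.
apply: hotel_ext => //; rewrite lifts_mk -[absorb _]/(rooms (check_in (check_out w))) e.
by rewrite lifts_mk rooms_mk addr_detourK.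
Qed.

(** For large distances the corrections [p - q] are bounded by [wsec_absorb_near];
    for small distances the continuity of [p] and [q] is used instead. *)
Lemma detour_dist_far (W : normedModType R) (b b' p p' q q' : W) :
  `|b + (p - q) - (b' + (p' - q'))| <= `|b - b'| + `|p - q| + `|p' - q'|.
Proof.
rewrite opprD addrACA; apply: le_trans (ler_normD _ _) _.
by rewrite -[leRHS]addrA lerD2l; exact: ler_normB.
Qed.

Lemma detour_dist_near (W : normedModType R) (b b' p p' q q' : W) :
  `|b + (p - q) - (b' + (p' - q'))| <= `|b - b'| + `|p - p'| + `|q - q'|.
Proof.
rewrite opprD addrACA; apply: le_trans (ler_normD _ _) _.
rewrite -[leRHS]addrA lerD2l opprD addrACA -opprD.
exact: ler_normB.
Qed.

Lemma check_in_coarse w z : `|check_in w - check_in z| <= 50 * `|w - z| + 8.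
Proof.
rewrite !hotel_normE roomsB liftsB roomsB liftsB !rooms_mk !lifts_mk.
have h1 := absorb_lip (rooms w) (rooms z).
have h2 := detour_dist_far (lifts w) (lifts z) (wsec (absorb (rooms w)))
  (wsec (absorb (rooms z))) (wsec (shift (rooms w))) (wsec (shift (rooms z))).
have h3 := wsec_absorb_near (rooms w); have h4 := wsec_absorb_near (rooms z).
have h5 := normr_ge0 (lifts w - lifts z); have h6 := normr_ge0 (rooms w - rooms z).
by move: h1 h2 h3 h4 h5 h6; norm_lra.
Qed.

Lemma check_out_coarse w z : `|check_out w - check_out z| <= 50 * `|w - z| + 8.
Proof.
rewrite !hotel_normE roomsB liftsB roomsB liftsB !rooms_mk !lifts_mk.
have h1 := unabsorb_lip (rooms w) (rooms z).
have h2 := detour_dist_far (lifts w) (lifts z) (wsec (shift (unabsorb (rooms w))))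
  (wsec (shift (unabsorb (rooms z)))) (wsec (rooms w)) (wsec (rooms z)).
have h3 := wsec_absorb_near (unabsorb (rooms w)).
have h4 := wsec_absorb_near (unabsorb (rooms z)).
rewrite !unabsorbK distrC in h3; rewrite !unabsorbK distrC in h4.
have h5 := normr_ge0 (lifts w - lifts z).
by move: h1 h2 h3 h4 h5; norm_lra.
Qed.

Lemma check_in_continuous : continuous check_in.
Proof.
apply: continuous_eps => w e e0; have e4 : 0 < e / 4 by lra.
have [d1 d10 H1] := wsec_continuous (absorb (rooms w)) e4.
have [d2 d20 H2] := wsec_continuous (shift (rooms w)) e4.
exists (Num.min (e / 200) (Num.min (d1 / 26) d2)).
  by rewrite !lt_min d20 !divr_gt0.
move=> z; rewrite !le_min => /and3P[].
rewrite !hotel_normE roomsB liftsB [rooms (_ - _)]roomsB [lifts (_ - _)]liftsB.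
rewrite !rooms_mk !lifts_mk => de d1e d2e.
have h1 := absorb_lip (rooms w) (rooms z).
have h2 := detour_dist_near (lifts w) (lifts z) (wsec (absorb (rooms w)))
  (wsec (absorb (rooms z))) (wsec (shift (rooms w))) (wsec (shift (rooms z))).
have h5 := normr_ge0 (lifts w - lifts z); have h6 := normr_ge0 (rooms w - rooms z).
have /H1 h3 : `|absorb (rooms w) - absorb (rooms z)| <= d1.
  by move: d1e; rewrite ler_pdivlMr//; move: h1 h5; norm_lra.
have /H2 h4 : `|shift (rooms w) - shift (rooms z)| <= d2.
  rewrite -shiftB; apply: le_trans (norm_shift _) _.
  by move: d2e h5; norm_lra.
by move: h1 h2 h3 h4 h5 h6 de; norm_lra.
Qed.

Lemma check_out_continuous : continuous check_out.
Proof.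
apply: continuous_eps => w e e0; have e4 : 0 < e / 4 by lra.
have [d1 d10 H1] := wsec_continuous (shift (unabsorb (rooms w))) e4.
have [d2 d20 H2] := wsec_continuous (rooms w) e4.
exists (Num.min (e / 200) (Num.min (d1 / 50) d2)).
  by rewrite !lt_min d20 !divr_gt0.
move=> z; rewrite !le_min => /and3P[].
rewrite !hotel_normE roomsB liftsB [rooms (_ - _)]roomsB [lifts (_ - _)]liftsB.
rewrite !rooms_mk !lifts_mk => de d1e d2e.
have h1 := unabsorb_lip (rooms w) (rooms z).
have h2 := detour_dist_near (lifts w) (lifts z) (wsec (shift (unabsorb (rooms w))))
  (wsec (shift (unabsorb (rooms z)))) (wsec (rooms w)) (wsec (rooms z)).
have h5 := normr_ge0 (lifts w - lifts z); have h6 := normr_ge0 (rooms w - rooms z).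
have /H1 h3 : `|shift (unabsorb (rooms w)) - shift (unabsorb (rooms z))| <= d1.
  rewrite -shiftB; apply: le_trans (norm_shift _) _.
  by move: d1e; rewrite ler_pdivlMr//; move: h1 h5; norm_lra.
have /H2 h4 : `|rooms w - rooms z| <= d2 by move: d2e h5; norm_lra.
by move: h1 h2 h3 h4 h5 h6 de; norm_lra.
Qed.

End Front.

(** * Separability *)

Section Coded.
Variable R : realType.

(** Separability in a form inherited by subspaces. *)
Definition coded (E : normedModType R) : Prop := forall e : R, 0 < e ->
  exists c : E -> nat, forall x y, c x = c y -> `|x - y| <= e.

Lemma coded_separable (E : normedModType R) : coded E -> separable E.
Proof.
move=> H.
have /choice[c cP] : forall m : nat, exists c : E -> nat,
    forall x y, c x = c y -> `|x - y| <= m.+1%:R^-1.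
  by move=> m; apply: H; rewrite invr_gt0.
pose rep (mk : nat * nat) : E := xget 0 [set x | c mk.1 x = mk.2].
exists (range rep); 
  first exact: (sub_countable (card_image_le rep setT) (countableP _)).
move=> O [x Ox] oO.
have /nbhs_ballP[e e0 eO] : nbhs x O by exact: open_nbhs_nbhs.
have [m me] : exists m : nat, m.+1%:R^-1 < e.
  have h := truncnS_gt e^-1; move: (Num.trunc _) h => m h; exists m.
  by rewrite -[e]invrK ltf_pV2 ?posrE ?invr_gt0.
exists (rep (m, c m x)); split; last by exists (m, c m x).
apply: eO; rewrite -ball_normE /=; apply: le_lt_trans me; apply: cP.
by rewrite /rep; case: xgetP => [y _ ->//|/(_ x)]; case.
Qed.

Lemma coded_count (E : normedModType R) : (forall e : R, 0 < e ->
    exists (T : countType) (c : E -> T), forall x y, c x = c y -> `|x - y| <= e) ->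
  coded E.
Proof.
move=> H e /H[T [c cP]]; exists (pickle \o c) => x y /= xy; apply: cP.
exact: (pcan_inj (@pickleK T)).
Qed.

Lemma coded_embed (E F : normedModType R) (f : E -> F) :
  (forall x y, `|x - y| <= `|f x - f y|) -> coded F -> coded E.
Proof.
move=> fE HF e /HF[c cP]; exists (c \o f) => x y /= /cP.
by apply: le_trans; exact: fE.
Qed.

Lemma coded_c0 : coded (c0 R).
Proof.
apply: coded_count => e e0; have e2 : 0 < e / 2 by lra.
have /choice[N NP] : forall x : c0 R, exists N,
    forall j, (N <= j)%N -> `|co x j| <= e / 2.
  by move=> x; exact: (co_vanish x e2).
exists (nat * seq int)%type,
  (fun x => (N x, [seq Num.floor (co x j / e) | j <- iota 0 (N x)])).
move=> x y [Nxy fl]; apply: norm_c0_le => j; rewrite coB.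
have [Nj|jN] := leqP (N x) j.
  apply: le_trans (ler_normB _ _) _; rewrite (splitr e) lerD ?NP//.
  by rewrite -Nxy.
rewrite -Nxy in fl; have /(_ j jN) : forall j, (j < N x)%N ->
    Num.floor (co x j / e) = Num.floor (co y j / e).
  move=> i iN; have /(congr1 (fun s => nth 0 s i)) := fl.
  by rewrite !(nth_map 0%N) ?size_iota// nth_iota// add0n.
move=> fxy.
have := real_floor_le (num_real (co x j / e)).
have := real_floor_le (num_real (co y j / e)).
have := real_floorD1_gt (num_real (co x j / e)).
have := real_floorD1_gt (num_real (co y j / e)).
rewrite fxy; move: (Num.floor _) => z.
rewrite !ler_pdivlMr// !ltr_pdivrMr// intrD mulrDl mul1r => h1 h2 h3 h4.
by rewrite ler_norml; apply/andP; split; lra.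
Qed.

(** The code of [x] records where the tail becomes small and the codes of the
    terms before, at a precision which depends on their number. *)
Lemma coded_l1 (V : completeNormedModType R) : coded V -> coded (l1 V).
Proof.
move=> HV; apply: coded_count => e e0; have e4 : 0 < e / 4 by lra.
have /choice[N NP] : forall x : l1 V, exists N, tail x N <= e / 4.
  by move=> x; have [N HN] := psum_approx x e4; exists N; rewrite /tail lerBlDl.
have /choice[c cP] : forall n : nat, exists c : V -> nat,
    forall x y, c x = c y -> `|x - y| <= e / 2 / n.+1%:R.
  by move=> n; apply: HV; rewrite divr_gt0//; lra.
exists (nat * seq nat)%type,
  (fun x => (N x, [seq c (N x) (tm x k) | k <- iota 0 (N x)])).
move=> x y [Nxy fl]; rewrite -Nxy in fl.
have cl k : (k < N x)%N -> `|tm (x - y) k| <= e / 2 / (N x).+1%:R.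
  move=> kN; rewrite tmB; apply: cP; have /(congr1 (fun s => nth 0%N s k)) := fl.
  by rewrite !(nth_map 0%N) ?size_iota// nth_iota// add0n.
have h1 : psum (tm (x - y)) (N x) <= e / 2.
  apply: (@le_trans _ _ (\sum_(k < N x) (e / 2 / (N x).+1%:R))).
    by apply: ler_sum => k _; exact: cl.
  rewrite sumr_const card_ord -[_ *+ N x]mulr_natr mulrAC ler_pdivrMr//.
  by rewrite ler_pM2l ?ler_nat//; lra.
have h2 := tailB x y (N x); have h3 := NP x; have h4 := NP y.
rewrite -Nxy in h4; rewrite /tail in h2 h3 h4.
by move: h1 h2 h3 h4; lra.
Qed.

Lemma coded_tri : coded (tri R).
Proof.
apply: (@coded_embed _ _ (@trv R)) (coded_l1 coded_c0).
by move=> x y; rewrite -trvB trv_norm.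
Qed.

Lemma coded_hotel d : coded (hotel R d).
Proof.
apply: coded_count => e e0; have e2 : 0 < e / 2 by lra.
have [c cP] := coded_l1 coded_c0 e2; have [c' cP'] := coded_l1 coded_tri e2.
exists (nat * nat)%type, (fun w => (c (rooms w), c' (lifts w))).
move=> w z [/cP h1 /cP' h2]; rewrite hotel_normE roomsB liftsB.
by rewrite (splitr e) lerD.
Qed.

End Coded.

(** * Concentration of uniformly continuous maps on interlaced sequences *)

Section Generic.
Variables (F : set_system nat) (FF : ProperFilter F).
Hypothesis F_tail : forall N, F [set n | (N <= n)%N].

(** [P] holds for generic [s] of size [K], the entries being chosen one after
    the other along [F]. *)
Fixpoint gen1 (K : nat) (P : seq nat -> Prop) : Prop :=
  if K is K'.+1 then F [set n | gen1 K' (fun s => P (n :: s))] else P [::].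

(** The entries of the two sequences are chosen alternately, which makes them
    interlaced ([gen2_interlaced]). *)
Fixpoint gen2 (K : nat) (P : seq nat -> seq nat -> Prop) : Prop :=
  if K is K'.+1 then
    F [set n | F [set m | gen2 K' (fun s t => P (n :: s) (m :: t))]]
  else P [::] [::].

Fixpoint interlaced (a : nat) (s t : seq nat) : Prop :=
  match s, t with
  | n :: s', m :: t' => [/\ (a <= n)%N, (n <= m)%N & interlaced m s' t']
  | _, _ => s = [::] /\ t = [::]
  end.

Lemma gen1S K (P Q : seq nat -> Prop) :
  (forall s, size s = K -> P s -> Q s) -> gen1 K P -> gen1 K Q.
Proof.
elim: K P Q => [|K IH] P Q PQ /=; first exact: PQ.
by apply: filterS => n /=; apply: IH => s sK; apply: PQ; rewrite /= sK.
Qed.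

Lemma gen2S K (P Q : seq nat -> seq nat -> Prop) :
  (forall s t, size s = K -> size t = K -> P s t -> Q s t) -> gen2 K P -> gen2 K Q.
Proof.
elim: K P Q => [|K IH] P Q PQ /=; first exact: PQ.
apply: filterS => n /=; apply: filterS => m /=; apply: IH => s t sK tK.
by apply: PQ; rewrite /= ?sK ?tK.
Qed.

Lemma gen1I K (P Q : seq nat -> Prop) :
  gen1 K P -> gen1 K Q -> gen1 K (fun s => P s /\ Q s).
Proof.
elim: K P Q => [|K IH] P Q //= HP HQ.
by apply: filterS2 HP HQ => n /=; exact: IH.
Qed.

Lemma gen2I K (P Q : seq nat -> seq nat -> Prop) :
  gen2 K P -> gen2 K Q -> gen2 K (fun s t => P s t /\ Q s t).
Proof.
elim: K P Q => [|K IH] P Q //= HP HQ.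
apply: filterS2 HP HQ => n /= HP HQ.
by apply: filterS2 HP HQ => m /=; exact: IH.
Qed.

Lemma gen1_true K (P : seq nat -> Prop) : (forall s, P s) -> gen1 K P.
Proof.
by elim: K P => //= K IH P HP; apply: filterE => n; apply: IH.
Qed.

Lemma gen1_forall K N (P : nat -> seq nat -> Prop) : (forall k, gen1 K (P k)) ->
  gen1 K (fun s => forall k, (k < N)%N -> P k s).
Proof.
move=> HP; elim: N => [|N IH]; first exact: gen1_true.
apply: gen1S (gen1I IH (HP N)) => s _ [H1 H2] k.
by rewrite ltnS leq_eqVlt => /orP[/eqP->//|]; exact: H1.
Qed.

Lemma gen2_fst K (P : seq nat -> Prop) : gen2 K (fun s _ => P s) -> gen1 K P.
Proof.
elim: K P => //= K IH P; apply: filterS => n /= /filter_ex[m]; exact: IH.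
Qed.

Lemma gen2_interlaced K a : gen2 K (interlaced a).
Proof.
elim: K a => //= K IH a.
apply: filterS (F_tail a) => n /= an; apply: filterS (F_tail n) => m /= nm.
by apply: gen2S (IH m).
Qed.

Lemma gen1_exists K P a : gen1 K P ->
  exists s, [/\ size s = K, all (leq a) s & P s].
Proof.
elim: K P => [|K IH] P /=; first by exists [::].
move=> HP; have [n [/= /IH[s [sK sa Ps]] an]] := filter_ex (filterI HP (F_tail a)).
by exists (n :: s); split => //=; rewrite ?sK// sa andbT.
Qed.

End Generic.

Section UltraLimits.
Variables (R : realType) (U : set_system nat) (UU : UltraFilter U).

Lemma ultra_lim (r : nat -> R) M : (forall n, `|r n| <= M) ->
  exists l, forall e, 0 < e -> U [set n | `|r n - l| <= e].
Proof.
move=> rM; pose A := [set a | U [set n | a <= r n]].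
have AM a : A a -> a <= M.
  move=> /filter_ex[n /= an]; apply: le_trans an _.
  by apply: le_trans (ler_norm _) (rM n).
have A0 : A (- M).
  by apply: filterE => n /=; have := rM n; rewrite ler_norml => /andP[].
have supA : has_sup A by split; [exists (- M)|exists M => a; exact: AM].
exists (sup A) => e e0.
have [a /= Aa aA] := sup_adherent e0 supA.
have Uup : U [set n | r n <= sup A + e].
  have [Ue|] := in_ultra_setVsetC [set n | sup A + e <= r n] UU.
    have : sup A + e <= sup A by apply: ub_le_sup => //; exists M => b; exact: AM.
    by rewrite gerDl leNgt e0.
  by apply: filterS => n /= /negP; rewrite -ltNge => /ltW.
apply: filterS2 Uup Aa => n /= h1 h2; rewrite ler_distl h1 andbT.
by apply: le_trans h2; exact: ltW.
Qed.

Lemma ultra_forall (P : nat -> set nat) m : (forall j, U (P j)) ->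
  U [set n | forall j, (j < m)%N -> P j n].
Proof.
move=> HP; elim: m => [|m IH]; first exact: filterE.
apply: filterS2 IH (HP m) => n /= H1 H2 j.
by rewrite ltnS leq_eqVlt => /orP[/eqP->//|]; exact: H1.
Qed.

(** Bounded sequences in [E] have limits along [U] for which distances split
    as in [l1] with its weak* topology. *)
Definition splits_limits (E : normedModType R) : Prop :=
  forall (z : nat -> E) M, (forall n, `|z n| <= M) ->
  exists l, `|l| <= M /\ forall a e, 0 < e ->
    U [set n | `|z n - l| + `|l - a| - e <= `|z n - a|].

(** Vectors which are small before [m] and vectors which are small beyond [m]
    are almost disjoint, and the norm of l1 is additive on disjoint vectors. *)
Lemma l1_dist_split (V : completeNormedModType R) (z l a : l1 V) m e :
  psum (tm (z - l)) m <= e -> tail l m <= e -> tail a m <= e ->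
  `|z - l| + `|l - a| - 6 * e <= `|z - a|.
Proof.
move=> zl te ae.
have h1 : psum (tm (l - a)) m <= psum (tm (z - l)) m + psum (tm (z - a)) m.
  have -> : l - a = (z - a) - (z - l) by rewrite opprB [RHS]addrC addrA subrK.
  by rewrite [leRHS]addrC psum_tmB.
have h2 := tailB l a m.
have h3 := tailB z l m.
have h4 := tailD (z - a) a m; rewrite subrK in h4.
rewrite /tail in te ae h2 h3 h4; move: zl te ae h1 h2 h3 h4.
by do ?[move: (psum _ _) => ?]; norm_lra.
Qed.

(** The limit is taken entrywise; each term of a vector of [tri] lies in a finite
    dimensional space, where this is convergence in norm. *)
Lemma tri_splits_limits : splits_limits (tri R).
Proof.
move=> z M zM.
have /choice[l lP] : forall ij : nat * nat, exists l, forall e, 0 < e ->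
    U [set n | `|co (tm (trv (z n)) ij.1) ij.2 - l| <= e].
  move=> [i j]; apply: (@ultra_lim _ M) => n /=.
  apply: le_trans (le_co_norm _ _) (le_trans (le_tm_norm _ _) _).
  by rewrite trv_norm.
have Lmem i : c0_mem (fun j => if (j <= i)%N then l (i, j) else 0).
  by move=> e e0; exists i.+1 => j ij; rewrite leqNgt ij normr0 ltW.
pose L i := mkc0 (Lmem i).
have Lblock i e : 0 < e -> U [set n | `|tm (trv (z n)) i - L i| <= e].
  move=> e0; have := ultra_forall i.+1 (fun j => lP (i, j) e e0).
  apply: filterS => n /= H; apply: norm_c0_le => j; rewrite coB co_mkc0.
  case: (leqP j i) => [ji|ij]; first exact: H.
  by rewrite (trv_supp (z n) ij) subrr normr0 ltW.
have Lpsum m e : 0 < e -> U [set n | psum (tm (trv (z n)) - L) m <= e].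
  elim: m e => [|m IH] e e0.
    by apply: filterE => n /=; rewrite /psum big_ord0 ltW.
  have e2 : 0 < e / 2 by lra.
  apply: filterS2 (IH _ e2) (Lblock m _ e2) => n /= h1 h2.
  by rewrite /psum big_ord_recr (splitr e) lerD.
have LM m : psum L m <= M.
  apply: le_eps => e e0; have [n /= Hn] := filter_ex (Lpsum m e e0).
  have -> : L = (-1) *: (tm (trv (z n)) - L) + tm (trv (z n)).
    by rewrite scaleN1r opprB subrK.
  apply: le_trans (psumD _ _ _) _; rewrite psumZ normrN1 mul1r addrC lerD//.
  by apply: le_trans (le_psum_norm _ _) _; rewrite trv_norm.
have Ll1 : l1_mem L by exists M.
have Ltri : tri_mem (mkl1 Ll1).
  by move=> i j ij; rewrite tm_mkl1 co_mkc0 leqNgt ij.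
exists (mktri Ltri); split; first exact: norm_l1_le.
move=> a e e0; have e6 : 0 < e / 6 by lra.
have [m1 H1] := psum_approx (mkl1 Ll1) e6.
have [m2 H2] := psum_approx (trv a) e6.
pose m := maxn m1 m2.
apply: filterS (Lpsum m _ e6) => n /= Hn.
have t1 : tail (mkl1 Ll1) m <= e / 6.
  rewrite /tail lerBlDl; apply: le_trans H1 _; rewrite lerD2r psum_homo//.
  exact: leq_maxl.
have t2 : tail (trv a) m <= e / 6.
  rewrite /tail lerBlDl; apply: le_trans H2 _; rewrite lerD2r psum_homo//.
  exact: leq_maxr.
have := @l1_dist_split _ (trv (z n)) (mkl1 Ll1) (trv a) m (e / 6) Hn t1 t2.
rewrite -!trv_norm !trvB trv_mktri; apply: le_trans.
by rewrite lerD2l lerN2 mulrC divfK.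
Qed.

End UltraLimits.

Section Concentration.
Variables (R : realType) (U : set_system nat) (UU : UltraFilter U).
Hypothesis U_tail : forall N, U [set n | (N <= n)%N].
Variable E : normedModType R.
Hypothesis E_splits : splits_limits U E.
Implicit Types (h g : seq nat -> E) (M : R).

Definition ulim (z : nat -> E) : E := xget 0 [set l |
  (forall M, (forall n, `|z n| <= M) -> `|l| <= M) /\
  forall a e, 0 < e -> U [set n | `|z n - l| + `|l - a| - e <= `|z n - a|]].

Lemma ulimP z M : (forall n, `|z n| <= M) -> `|ulim z| <= M /\
  forall a e, 0 < e ->
    U [set n | `|z n - ulim z| + `|ulim z - a| - e <= `|z n - a|].
Proof.
move=> zM; rewrite /ulim; case: xgetP => [l _ [/(_ M zM) h1 h2] //|].
pose M' := sup_of (fun n => `|z n|).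
have zM' n : `|z n| <= M' by exact: (sup_of_ub zM).
have [l [lM lP]] := E_splits zM'.
move=> /(_ l); case; split => // N zN.
by apply: le_trans lM _; exact: sup_of_le.
Qed.

(** The iterated limit of [h] over sequences of size [K]. *)
Fixpoint centre (K : nat) h : E :=
  if K is K'.+1 then ulim (fun n => centre K' (fun s => h (n :: s))) else h [::].

Lemma centre_le K h M : (forall s, size s = K -> `|h s| <= M) ->
  `|centre K h| <= M.
Proof.
elim: K h => [|K IH] h hM /=; first exact: hM.
have [] // := @ulimP (fun n => centre K (fun s => h (n :: s))) M.
by move=> n; apply: IH => s sK; apply: hM; rewrite /= sK.
Qed.

(** The differences between consecutive iterated limits of [h] and [g] are
    disjoint in the limit, hence the norm of [h s - g t] is the sum of all of
    them; two independent functions are needed for the induction. *)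
Lemma gen2_centre K h g M e : (forall s, size s = K -> `|h s| <= M) ->
  (forall s, size s = K -> `|g s| <= M) -> 0 < e ->
  gen2 U K (fun s t => `|h s - centre K h| + `|g t - centre K g|
    + `|centre K h - centre K g| - e <= `|h s - g t|).
Proof.
elim: K h g e => [|K IH] h g e hM gM e0.
  by rewrite /= !subrr !normr0 !add0r gerBl ltW.
have hM' n s : size s = K -> `|h (n :: s)| <= M.
  by move=> sK; apply: hM; rewrite /= sK.
have gM' n s : size s = K -> `|g (n :: s)| <= M.
  by move=> sK; apply: gM; rewrite /= sK.
have e4 : 0 < e / 4 by lra.
have e2 : 0 < e / 2 by lra.
rewrite /=.
set ch := fun n => centre K (fun s => h (n :: s)).
set cg := fun n => centre K (fun s => g (n :: s)).
have [_ hP] := @ulimP ch M (fun n => centre_le (hM' n)).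
have [_ gP] := @ulimP cg M (fun n => centre_le (gM' n)).
apply: filterS (hP (ulim cg) _ e4) => n /= Hn.
apply: filterS (gP (ch n) _ e4) => m /= Hm.
apply: gen2S (IH _ _ _ (hM' n) (gM' m) e2) => s t _ _.
rewrite -/(ch n) -/(cg m) => H.
have t1 := ler_distD (ch n) (h (n :: s)) (ulim ch).
have t2 := ler_distD (cg m) (g (m :: t)) (ulim cg).
rewrite (distrC (ulim cg) (ch n)) (distrC (cg m) (ch n)) in Hm.
by move: Hn Hm H t1 t2; lra.
Qed.

(** The oscillation over interlaced pairs bounds the oscillation over all generic
    sequences, independently of their size [K]. *)
Lemma gen1_concentrated K h M a w e : (forall s, size s = K -> `|h s| <= M) ->
  (forall s t, size s = K -> size t = K -> interlaced a s t -> `|h s - h t| <= w) ->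
  0 < e -> gen1 U K (fun s => `|h s - centre K h| <= w + e).
Proof.
move=> hM hw e0; apply: gen2_fst.
apply: gen2S (gen2I _ (gen2_interlaced _ U_tail K a) (gen2_centre hM hM e0)).
move=> s t sK tK [/(hw _ _ sK tK) H1 H2].
have h1 := normr_ge0 (h t - centre K h).
by move: H1 H2; rewrite subrr normr0; lra.
Qed.

End Concentration.

(** * No uniform homeomorphism *)

Section LargeScale.
Variables (R : realType) (E F : normedModType R).

Definition ucont (g : E -> F) : Prop := forall e : R, 0 < e ->
  exists2 d, 0 < d & forall x y, `|x - y| <= d -> `|g x - g y| <= e.

Lemma unif_continuous_ucont (g : E -> F) : unif_continuous g -> ucont g.
Proof.
move=> /unif_continuousP gc e /gc[d /= d0 gd]; exists (d / 2); first by lra.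
move=> x y xy; have := gd (x, y); rewrite -!ball_normE /= => H.
by apply/ltW/H; apply: le_lt_trans xy _; lra.
Qed.

(** A segment of length [n d] is cut into [n] steps of length [d]. *)
Lemma ucont_coarse_lipschitz (g : E -> F) : ucont g ->
  exists2 L : R, 0 < L & forall x y, `|g x - g y| <= L * `|x - y| + 1.
Proof.
move=> /(_ 1 ltr01)[d d0 gd].
have H n x y : `|x - y| <= n%:R * d -> `|g x - g y| <= n%:R.
  elim: n x y => [|n IH] x y xy.
    have -> : x = y by apply/eqP; rewrite -subr_eq0 -normr_le0; move: xy; rewrite mul0r.
    by rewrite subrr normr0.
  pose z := x - n.+1%:R^-1 *: (x - y).
  have n0 : 0 < (n.+1%:R : R) by [].
  have xz : x - z = n.+1%:R^-1 *: (x - y) by rewrite /z opprB addrC subrK.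
  have zy : z - y = (n%:R / n.+1%:R) *: (x - y).
    rewrite /z addrAC -{1}[x - y]scale1r -scalerBl; congr (_ *: _).
    by rewrite -natr1; field; rewrite natr1 gt_eqF.
  apply: le_trans (ler_distD (g z) _ _) _; rewrite -natr1 addrC; apply: lerD.
    apply: IH; rewrite zy normrZ ger0_norm ?divr_ge0//.
    rewrite mulrAC ler_pdivrMr// -mulrA ler_wpM2l//.
    by rewrite mulrC.
  apply: gd; rewrite xz normrZ gtr0_norm ?invr_gt0//.
  by rewrite mulrC ler_pdivrMr// mulrC.
exists d^-1; first by rewrite invr_gt0.
move=> x y; have q0 : 0 <= d^-1 * `|x - y| by rewrite mulr_ge0// invr_ge0 ltW.
have h1 := truncnS_gt (d^-1 * `|x - y|).
apply: le_trans (H (Num.trunc (d^-1 * `|x - y|)).+1 x y _) _.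
  by rewrite -ler_pdivrMr// mulrC ltW.
by rewrite -natr1 lerD2r truncn_le.
Qed.

End LargeScale.

Section Staircases.
Variables (R : realType) (J : nat).
Local Notation X := (c0 R).
Implicit Types (s t : seq nat).

Lemma step_mem n : c0_mem (fun j => ((J < j)%N && (j <= n)%N)%:R : R).
Proof.
move=> e e0; exists n.+1 => j nj.
by rewrite [(j <= n)%N]leqNgt nj andbF normr0 ltW.
Qed.

(** Sums of indicator functions of the intervals [(J, n]], [n] in [s]: vectors
    of c0 which move slowly under interlaced changes of [s], yet may reach
    distance [size s]. *)
Definition stair s : X := \sum_(n <- s) mkc0 (step_mem n).

Lemma co_stair s j :
  co (stair s) j = if (J < j)%N then (count (leq j) s)%:R else 0.
Proof.
rewrite /stair co_sum; elim: s => [|n s IH]; first by rewrite big_nil if_same.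
rewrite big_cons IH co_mkc0 /=; case: ifP => Jj /=; last by rewrite addr0.
by rewrite natrD.
Qed.

Lemma norm_stair s : `|stair s| <= (size s)%:R.
Proof.
apply: norm_c0_le => j; rewrite co_stair; case: ifP => _; last by rewrite normr0.
by rewrite ger0_norm// ler_nat count_size.
Qed.

Lemma interlaced_count a s t j : interlaced a s t ->
  [/\ (count (leq j) s <= count (leq j) t)%N,
      (count (leq j) t <= (count (leq j) s).+1)%N &
      ((j <= a)%N -> count (leq j) s = count (leq j) t)].
Proof.
elim: s a t => [|n s IH] a [|m t] //=; try by case.
move=> [an nm /IH[h1 h2 h3]].
have [jn|nj] := leqP j n.
  by have jm := leq_trans jn nm; rewrite jm (h3 jm).
have [jm|mj] := leqP j m.
  rewrite (h3 jm); split => // ja.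
  by have := leq_trans ja an; rewrite leqNgt nj.
split => // ja; have := leq_trans ja (leq_trans an nm).
by rewrite leqNgt mj.
Qed.

Lemma interlaced_stair a s t : interlaced a s t -> `|stair s - stair t| <= 1.
Proof.
move=> /interlaced_count st; apply: norm_c0_le => j; rewrite coB !co_stair.
have [h1 h2 _] := st j; case: ifP => _; last by rewrite subrr normr0.
have {}h1 : (count (leq j) s)%:R <= (count (leq j) t)%:R :> R by rewrite ler_nat.
have {}h2 : (count (leq j) t)%:R <= (count (leq j) s)%:R + 1 :> R.
  by rewrite natr1 ler_nat.
by rewrite ler_norml; apply/andP; split; lra.
Qed.

Lemma separated_stair s t b : (J < b)%N -> all (fun n => n < b)%N s ->
  all (leq b) t -> (size t)%:R <= `|stair s - stair t|.
Proof.
move=> Jb sb tb; apply: le_trans (le_co_norm _ b).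
rewrite coB !co_stair Jb; move: tb; rewrite all_count => /eqP ->.
have -> : count (leq b) s = 0%N.
  apply/eqP; rewrite -leqn0 leqNgt -has_count; apply/hasPn => n /(allP sb).
  by rewrite ltnNge.
by rewrite sub0r normrN ger0_norm.
Qed.

End Staircases.

Section Midpoints.
Variable R : realType.
Local Notation X := (c0 R).
Local Notation B := (hotel R 0).
Implicit Types (w z : B) (N : nat).

Definition head_norm w N : R := psum (tm (rooms w)) N + psum (tm (lifts w)) N.
Definition tail_norm w N : R := tail (rooms w) N + tail (lifts w) N.

Lemma head_tail w N : `|w| = head_norm w N + tail_norm w N.
Proof. by rewrite hotel_normE /head_norm /tail_norm /tail; ring. Qed.

Lemma tail_normB w z N : tail_norm (w - z) N <= tail_norm w N + tail_norm z N.
Proof.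
rewrite /tail_norm roomsB liftsB [leRHS]addrACA.
by apply: lerD; exact: tailB.
Qed.

Lemma tail_normD w z N : tail_norm (w + z) N <= tail_norm w N + tail_norm z N.
Proof.
rewrite /tail_norm roomsD liftsD [leRHS]addrACA.
by apply: lerD; exact: tailD.
Qed.

Lemma head_normB w z N : head_norm (w - z) N <= head_norm w N + head_norm z N.
Proof.
rewrite /head_norm roomsB liftsB [leRHS]addrACA.
by apply: lerD; exact: psum_tmB.
Qed.

Lemma tail_small (a b : B) e : 0 < e ->
  exists N, tail_norm a N <= e /\ tail_norm b N <= e.
Proof.
move=> e0; have e2 : 0 < e / 2 by lra.
have [n1 H1] := psum_approx (rooms a) e2; have [n2 H2] := psum_approx (lifts a) e2.
have [n3 H3] := psum_approx (rooms b) e2; have [n4 H4] := psum_approx (lifts b) e2.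
pose N := maxn (maxn n1 n2) (maxn n3 n4).
have le (V : completeNormedModType R) (x : l1 V) n : (n <= N)%N ->
    `|x| <= psum (tm x) n + e / 2 -> tail x N <= e / 2.
  move=> nN xn; rewrite /tail lerBlDl; apply: le_trans xn _.
  by rewrite lerD2r psum_homo.
exists N; rewrite /tail_norm (splitr e); split; apply: lerD.
- by apply: le H1; rewrite /N !leq_max leqnn ?orbT.
- by apply: le H2; rewrite /N !leq_max leqnn ?orbT.
- by apply: le H3; rewrite /N !leq_max leqnn ?orbT.
- by apply: le H4; rewrite /N !leq_max leqnn ?orbT.
Qed.

(** The heads of [w - a] and [w - b] already use up the distance from [a] to
    [b], and the norm is additive over heads and tails. *)
Lemma midpoint_tail w a b N e r r' :
  tail_norm a N <= e -> tail_norm b N <= e ->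
  `|w - a| <= r -> `|w - b| <= r -> 2 * r' <= `|a - b| ->
  tail_norm w N <= r - r' + 2 * e.
Proof.
move=> ae be wa wb ab.
have h1 : head_norm (a - b) N <= head_norm (w - b) N + head_norm (w - a) N.
  have -> : a - b = (w - b) - (w - a) by rewrite opprB [RHS]addrC addrA subrK.
  exact: head_normB.
have h2 := tail_normB a b N.
have h3 := tail_normD (w - a) a N; rewrite subrK in h3.
have h4 := tail_normD (w - b) b N; rewrite subrK in h4.
rewrite (head_tail (w - a) N) in wa; rewrite (head_tail (w - b) N) in wb.
rewrite (head_tail (a - b) N) in ab.
move: ae be wa wb ab h1 h2 h3 h4.
move: (head_norm (a - b) N) (head_norm (w - a) N) (head_norm (w - b) N).
move: (tail_norm (a - b) N) (tail_norm (w - a) N) (tail_norm (w - b) N)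
  (tail_norm a N) (tail_norm b N) (tail_norm w N) => *.
by lra.
Qed.

Lemma head_le_lifts w N W e : (forall k, (k < N)%N -> `|tm (lifts w) k| <= e) ->
  W = \sum_(k < N) (2 ^+ k.+1 + 1) -> head_norm w N <= W * e.
Proof.
move=> we ->; rewrite /head_norm /psum -big_split mulr_suml; apply: ler_sum => k _.
rewrite mulrDl mul1r; apply: lerD; last exact: we.
apply: le_trans (room_le_lift w k) _.
by rewrite ler_wpM2l ?exprn_ge0// we.
Qed.

(** Let [l0] be the infimum of the Lipschitz constants valid for large distances:
    [l] is slightly larger than [l0] and [l'] slightly smaller. *)
Lemma near_extremal (f : X -> B) (L kap th : R) : 0 < L -> 0 < kap -> 0 < th ->
  (forall x y, `|f x - f y| <= L * `|x - y| + 1) ->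
  exists l l' tau (u v : X), [/\ th <= tau, `|u - v| = 2 * tau, l - l' <= 2 * kap,
    (forall x y, tau <= `|x - y| -> `|f x - f y| <= l * `|x - y|) &
    2 * (l' * tau) <= `|f u - f v| ].
Proof.
move=> L0 kap0 th0 fL.
pose A := [set l : R | exists th', forall x y : X, th' <= `|x - y| ->
  `|f x - f y| <= l * `|x - y|].
have A1 : A (L + 1).
  exists 1 => x y xy; apply: le_trans (fL x y) _.
  by rewrite mulrDl mul1r lerD2l.
have A0 l : A l -> 0 <= l.
  (* Any constant in [A] is tested on a pair of points at a large distance. *)
  move=> [th' /(_ (Num.max th' 1 *: stair R 0 [:: 1%N]) 0)].
  have e1 : `|stair R 0 [:: 1%N]| = 1.
    apply/eqP; rewrite eq_le (norm_stair R 0 [:: 1%N])/=.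
    by apply: le_trans (le_co_norm _ 1%N); rewrite co_stair/= normr1.
  have m1 : 1 <= Num.max th' 1 by rewrite le_max lexx orbT.
  have m0 : 0 < Num.max th' 1 by exact: lt_le_trans m1.
  rewrite subr0 normrZ e1 mulr1 gtr0_norm// => /(_ _)H.
  rewrite -(pmulr_lge0 _ m0); apply: le_trans (H _) => //.
  by rewrite le_max lexx.
have infA : has_inf A by split; [exists (L + 1)|exists 0 => l; exact: A0].
have [l [th' lth'] lA] := inf_adherent kap0 infA.
have nA : ~ A (inf A - kap).
  move=> /(ge_inf (proj2 infA)); rewrite lerBrDr.
  by rewrite gerDl leNgt kap0.
pose T := 2 * Num.max th th'.
have [u [v [uvT fuv]]] : exists u v : X, T <= `|u - v| /\
    (inf A - kap) * `|u - v| < `|f u - f v|.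
  apply: contrapT => H; apply: nA; exists T => x y xyT.
  rewrite leNgt; apply/negP => xy; apply: H; by exists x, y.
exists l, (inf A - kap), (`|u - v| / 2), u, v.
have mT : Num.max th th' <= `|u - v| / 2.
  by rewrite ler_pdivlMr// mulrC.
split.
- by apply: le_trans mT; rewrite le_max lexx.
- by rewrite mulrC divfK.
- by move: lA; lra.
- move=> x y xy; apply: lth'; apply: le_trans xy; apply: le_trans mT.
  by rewrite le_max lexx orbT.
- by apply/ltW/(le_lt_trans _ fuv); rewrite le_eqVlt; apply/orP; left; apply/eqP; field.
Qed.

(** The norm of c0 is a supremum, and beyond [J] the entries of [u - v] leave
    room for a perturbation of size [tau / 2]. *)
Lemma midpoint_ball (u v : X) tau : `|u - v| = 2 * tau -> 0 < tau ->
  exists J, forall g : X, (forall j, (j <= J)%N -> co g j = 0) -> `|g| <= tau / 2 ->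
    `|2^-1 *: (u + v) + g - u| = tau /\ `|2^-1 *: (u + v) + g - v| = tau.
Proof.
move=> uv tau0; have [J HJ] := co_vanish (u - v) tau0.
exists J => g gJ gt.
have bound (a b : X) : (forall j, `|co (a - b) j| <= 2 * tau) ->
    (forall j, (J <= j)%N -> `|co (a - b) j| <= tau) ->
    `|2^-1 *: (a + b) + g - a| <= tau.
  move=> ab abJ; apply: norm_c0_le => j; rewrite coB coD coZ coD.
  have := ab j; rewrite coB ler_norml => /andP[h1 h2].
  rewrite ler_norml; have [jJ|Jj] := leqP j J.
    by rewrite gJ//; apply/andP; split; lra.
  have := abJ j (ltnW Jj); rewrite coB ler_norml => /andP[h3 h4].
  have := le_trans (le_co_norm g j) gt; rewrite ler_norml => /andP[h5 h6].
  by apply/andP; split; lra.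
have cuv j : `|co (u - v) j| <= 2 * tau by rewrite -uv le_co_norm.
have b1 := bound u v cuv HJ.
have b2 : `|2^-1 *: (u + v) + g - v| <= tau.
  rewrite [u + v]addrC; apply: bound => j.
    by rewrite coB distrC -coB.
  by move=> /HJ; rewrite coB distrC -coB.
have b3 := ler_distD (2^-1 *: (u + v) + g) u v.
rewrite uv (distrC u) in b3.
by split; apply/eqP; rewrite eq_le ?b1 ?b2/=; move: b1 b2 b3; norm_lra.
Qed.

End Midpoints.

Section NoEmbedding.
Variable R : realType.
Local Notation X := (c0 R).
Local Notation B := (hotel R 0).

Lemma bounded_above (J : nat) (s : seq nat) :
  exists b, (J < b)%N /\ all (fun n => (n < b)%N) s.
Proof.
elim: s => [|n s [b [Jb sb]]]; first by exists J.+1.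
exists (maxn b n.+1); split; first by rewrite leq_max Jb.
rewrite /= leq_max leqnn orbT /=; apply: sub_all sb => m mb.
by rewrite leq_max mb.
Qed.

(** Midpoints of a nearly extremal pair are sent to finitely many summands, up to
    an error which is small compared with [q = tau / L]; on the midpoints given
    by staircases the map concentrates there. The lower estimate for [f] is
    contradicted by two staircases at distance [tau / 2]. *)
Lemma no_embedding (f : X -> B) (L : R) : 0 < L -> ucont f ->
  (forall x y, `|f x - f y| <= L * `|x - y| + 1) ->
  (forall x y, `|x - y| <= L * `|f x - f y| + 1) -> False.
Proof.
move=> L0 fu fL Lf.
have kap0 : 0 < (32 * L)^-1 by rewrite invr_gt0 mulr_gt0.
have [l [l' [tau [u [v [tau4 uv ll' lP l'P]]]]]] :=
  near_extremal L0 kap0 (ltr0n R 4) fL.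
have tau0 : 0 < tau by apply: lt_le_trans tau4.
have [J HJ] := midpoint_ball uv tau0.
pose q := tau / L; have q0 : 0 < q by rewrite divr_gt0.
have Lq : L * q = tau by rewrite /q mulrC divfK// gt_eqF.
have llq : l * tau - l' * tau <= q / 16.
  have -> : q / 16 = 2 * (32 * L)^-1 * tau by rewrite /q; field; rewrite gt_eqF.
  by rewrite -mulrBl ler_wpM2r// ltW.
have eta0 : 0 < q / 64 by rewrite divr_gt0.
have [N [uN vN]] := tail_small (f u) (f v) eta0.
(* On the first [N] summands [W] bounds the norm by the norms of the lifts. *)
pose W : R := \sum_(k < N) (2 ^+ k.+1 + 1).
have W0 : 0 <= W by apply: sumr_ge0 => k _; rewrite addr_ge0// exprn_ge0.
pose w := q / 128 / (W + 1).
have W1 : 0 < W + 1 by rewrite ltr_wpDl.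
have w0 : 0 < w by rewrite !divr_gt0.
have [d d0 fd] := fu w w0.
(* [K] steps of height [t <= d] reach the height [tau / 2]. *)
pose K := (Num.trunc (tau / 2 / d)).+1.
pose t := tau / 2 / K%:R.
have K0 : 0 < (K%:R : R) by [].
have t0 : 0 < t by rewrite !divr_gt0.
have td : t <= d.
  rewrite /t ler_pdivrMr// -ler_pdivrMl// mulrC; apply/ltW.
  exact: truncnS_gt.
have tK : t * K%:R = tau / 2 by rewrite divfK// gt_eqF.
pose mid s := 2^-1 *: (u + v) + t *: stair R J s.
have midB s s' : mid s - mid s' = t *: (stair R J s - stair R J s').
  by rewrite /mid opprD addrACA subrr add0r scalerBr.
have midP s : size s = K -> `|mid s - u| = tau /\ `|mid s - v| = tau.
  move=> sK; apply: HJ.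
    by move=> j jJ; rewrite coZ co_stair ltnNge jJ mulr0.
  by rewrite normrZ gtr0_norm// -tK ler_pM2l// -sK norm_stair.
have fmid s : size s = K ->
    `|f (mid s) - f u| <= l * tau /\ `|f (mid s) - f v| <= l * tau.
  move=> /midP[mu mv].
  have := lP (mid s) u; have := lP (mid s) v; rewrite mu mv => H1 H2.
  by split; [exact: H2|exact: H1].
have mid_tail s : size s = K -> tail_norm (f (mid s)) N <= q / 16 + q / 32.
  move=> /fmid[mu mv]; apply: le_trans (midpoint_tail uN vN mu mv l'P) _.
  by rewrite lerD// le_eqVlt; apply/orP; left; apply/eqP; field.
pose h k s := tm (lifts (f (mid s))) k.
pose M := `|f u| + l * tau.
have hM k s : size s = K -> `|h k s| <= M.
  move=> /fmid[mu _]; apply: le_trans (le_tm_norm _ _) _.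
  apply: (@le_trans _ _ `|f (mid s)|); first by rewrite [leRHS]hotel_normE lerDr.
  rewrite -[f (mid s)](subrK (f u)) addrC.
  by apply: le_trans (ler_normD _ _) _; rewrite lerD2l.
have hw k s s' : size s = K -> size s' = K -> interlaced 0 s s' ->
    `|h k s - h k s'| <= w.
  move=> _ _ ss'; rewrite -tmB -liftsB; apply: le_trans (le_tm_norm _ _) _.
  apply: (@le_trans _ _ `|f (mid s) - f (mid s')|).
    by rewrite [leRHS]hotel_normE lerDr.
  apply: fd; apply: le_trans td; rewrite midB normrZ gtr0_norm//.
  by apply: ler_piMr; [exact: ltW | exact: (interlaced_stair R J ss')].
have [U [UU oU]] := ultraFilterLemma eventually_filter.
have U_tail n : U [set m | (n <= m)%N] by apply: oU; exists n.
pose c k := centre U K (h k).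
have conc k : gen1 U K (fun s => `|h k s - c k| <= w + w).
  exact: (gen1_concentrated UU U_tail (tri_splits_limits UU) (hM k) (hw k) w0).
have UP : ProperFilter U by exact: ultra_proper.
have concN := gen1_forall UP N conc.
have [s [sK _ sc]] := gen1_exists UP U_tail 0 concN.
have [b [Jb sb]] := bounded_above J s.
have [s' [s'K bs' s'c]] := gen1_exists UP U_tail b concN.
pose D := f (mid s) - f (mid s').
have Dk k : (k < N)%N -> `|tm (lifts D) k| <= 4 * w.
  move=> kN; rewrite /D liftsB tmB.
  have := sc k kN; have := s'c k kN.
  have := ler_distD (c k) (h k s) (h k s'); rewrite (distrC (c k)) /h.
  by move: (`|_ - _|) (`|_ - _|) (`|_ - _|) => x y z; clear; lra.
have Dhead : head_norm D N <= q / 32.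
  apply: le_trans (head_le_lifts Dk (erefl _)) _; rewrite -/W.
  have -> : q / 32 = (W + 1) * (4 * w).
    by rewrite /w; field; rewrite gt_eqF.
  by rewrite ler_wpM2r ?lerDl// mulr_ge0// ltW.
have Dtail : tail_norm D N <= q / 8 + q / 16.
  have := tail_normB (f (mid s)) (f (mid s')) N; rewrite -/D.
  have := mid_tail s sK; have := mid_tail s' s'K.
  move: (tail_norm _ N) (tail_norm _ N) (tail_norm _ N) => x y z.
  by move: (q) => r; clear; lra.
have far : tau / 2 <= `|mid s - mid s'|.
  rewrite midB normrZ gtr0_norm// -tK ler_pM2l// -s'K.
  exact: (separated_stair R Jb sb bs').
have := Lf (mid s) (mid s'); rewrite -/D (head_tail D N) => low.
have : L * (head_norm D N + tail_norm D N) <= L * (7 / 32 * q).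
  rewrite ler_pM2l//; move: Dhead Dtail.
  by move: (head_norm _ _) (tail_norm _ _) (q) => x y z; clear; lra.
move: low far tau4 Lq; move: (`|_|) (head_norm _ _ + _) (q) (L) (tau) => x y z a e; clear.
by lra.
Qed.

Lemma lobby_mem (x : X) : l1_mem (fun k => if k == 0%N then x else 0).
Proof.
exists `|x| => -[|n]; first by rewrite /psum big_ord0.
by rewrite /psum big_ord_recl /= big1 ?addr0// => i _; rewrite normr0.
Qed.

Lemma lobby_hotel (x : X) : hotel_mem 1 (mkl1 (lobby_mem x), 0 : l1 (tri R)).
Proof.
move=> k; rewrite tm_mkl1 scaler0; have -> : tm (trv (tm (0 : l1 (tri R)) k)) = (fun=> 0).
  by apply/funext => j; rewrite tm0.
exact: sums_to0.
Qed.

(** The copy of c0 that distinguishes the first space from the second. *)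
Definition lobby (x : X) : hotel R 1 := mkhotel (lobby_hotel x).

Lemma lobby_dist (x y : X) : `|lobby x - lobby y| = `|x - y|.
Proof.
rewrite hotel_normE roomsB liftsB !rooms_mk !lifts_mk subrr normr0 addr0.
apply/eqP; rewrite eq_le; apply/andP; split.
  apply: norm_l1_le => -[|n]; first by rewrite /psum big_ord0.
  rewrite /psum big_ord_recl /= big1 ?addr0// => i _.
  by rewrite tmB !tm_mkl1 subrr normr0.
exact: le_trans (le_tm_norm _ 0).
Qed.

Lemma not_uniformly_homeomorphic : ~ uniformly_homeomorphic (hotel R 1) (hotel R 0).
Proof.
move=> [F [G [FK _ /unif_continuous_ucont Fc /unif_continuous_ucont Gc]]].
have [L1 L10 FL] := ucont_coarse_lipschitz Fc.
have [L2 L20 GL] := ucont_coarse_lipschitz Gc.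
apply: (@no_embedding (F \o lobby) (L1 + L2)).
- exact: addr_gt0.
- move=> e /Fc[d d0 Fd]; exists d => // x y xy.
  by apply: Fd; rewrite lobby_dist.
- move=> x y; apply: le_trans (FL _ _) _; rewrite lobby_dist lerD2r ler_wpM2r//.
  by rewrite lerDl ltW.
- move=> x y; have := GL (F (lobby x)) (F (lobby y)); rewrite !FK lobby_dist.
  move=> /le_trans; apply; rewrite lerD2r ler_wpM2r//.
  by rewrite lerDr ltW.
Qed.

End NoEmbedding.

Theorem corollary1p8 (R : realType) :
  exists X Y : completeNormedModType R,
    [/\ separable X, separable Y,
        exists f : X -> Y, homeomorphism f /\ coarse_equivalence f
      & ~ uniformly_homeomorphic X Y].
Proof.
exists (hotel R 1), (hotel R 0); split.
- exact/coded_separable/coded_hotel.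
- exact/coded_separable/coded_hotel.
- exists (@check_in R); split.
    exists (@check_out R); split; [exact: check_inK|exact: check_outK| |].
      exact: check_in_continuous.
    exact: check_out_continuous.
  apply: (@coarse_equivalence_of_inverse _ _ _ _ (@check_out R) 50 8) => //.
  + exact: check_inK.
  + exact: check_outK.
  + exact: check_in_coarse.
  + exact: check_out_coarse.
- exact: not_uniformly_homeomorphic.
Qed.
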